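(* If a graph $G=(V,E)$ has doubling dimension $d$, then it admits a strong-diameter $(\rho,\mu)$-hierarchical partition family $\mathfrak{P}$ of size $2^{\tilde{O}(d)}$ with $\rho = O(1)$ and $\mu = \tilde{O}(d^3)$, such that the maximum degree of any cluster in any hierarchical partition in $\mathfrak{P}$ is at most $\mu^{O(d)}$.
   Context: $G$ is a connected edge-weighted graph; its doubling dimension is that of its shortest-path metric $d_G$ (every ball of radius $r>0$ can be covered by at most $2^d$ balls of radius $r/2$). A strong-diameter $\mu$-hierarchical partition ($\mu$-HP) of $G$ is a sequence of partitions $\mathbb{P}=(P_0,P_1,\dots,P_{i_{\max}})$ of $V$ such that: every cluster of $P_0$ is a single vertex and $P_{i_{\max}}$ consists of one cluster containing all vertices; for every $i$, every cluster $C\in P_i$ satisfies $\max_{u,v\in C} d_{G[C]}(u,v)\le \mu^i$ (strong diameter, measured in the induced subgraph $G[C]$); and every cluster of $P_i$ is a union of clusters of $P_{i-1}$. Viewing $\mathbb{P}$ as a tree, the children of $C\in P_i$ are the clusters of $P_{i-1}$ whose union is $C$, and the degree of $C$ is its number of children. A strong-diameter $(\rho,\mu)$-hierarchical partition family ($(\rho,\mu)$-HPF) is a set $\mathfrak{P}=\{\mathbb{P}^1,\dots,\mathbb{P}^\sigma\}$ of strong-diameter $\mu$-HPs such that for every vertex $v$ and every $i\in\mathbb{N}$ there exist $j$ and a cluster $C$ in the scale-$i$ partition $P^j_i$ of $\mathbb{P}^j$ with the ball $B(v,\mu^i/\rho)=\{u: d_G(u,v)\le \mu^i/\rho\}$ contained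 in $C$. $\sigma$ is the size, $\rho$ the padding, $\mu$ the growth factor. $\tilde O(g)$ hides polylogarithmic factors in $g$.
   Formalization: The graph is assumed normalized so that distinct vertices are at distance at least 1; without this the claim fails, since single-vertex clusters of P_0 cannot contain balls of radius 1/ρ when edge weights are tiny. *)

(* Defs.v *)
From HB Require Import structures.
From mathcomp Require Import all_boot all_order all_algebra.
From mathcomp Require Import all_classical all_reals all_analysis.

Set Implicit Arguments.
Unset Strict Implicit.
Unset Printing Implicit Defensive.
Import Order.TTheory GRing.Theory Num.Theory.
Local Open Scope ring_scope.

(* [weight x y] is meaningful only when [adj x y]. *)
Record wgraph (R : realType) (V : finType) := WGraph {
  adj : rel V;
  weight : V -> V -> R;
  adj_sym : symmetric adj;
  adj_irr : irreflexive adj;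
  weight_sym : forall x y, weight x y = weight y x;
  weight_gt0 : forall x y, adj x y -> 0 < weight x y }.

Section Graph.
Variables (R : realType) (V : finType).
Implicit Types (G : wgraph R V) (C : {set V}) (P : seq {set {set V}}).

(* G[C] is represented on the whole of V: the vertices outside C become
   isolated, which does not affect distances between vertices of C. *)
Definition induced_adj G C : rel V :=
  [rel x y | [&& x \in C, y \in C & adj G x y]].

Lemma induced_sym G C : symmetric (induced_adj G C).
Proof. by move=> x y; rewrite /induced_adj /= adj_sym andbCA. Qed.

Lemma induced_irr G C : irreflexive (induced_adj G C).
Proof. by move=> x; rewrite /induced_adj /= adj_irr !andbF. Qed.

Lemma induced_gt0 G C x y : induced_adj G C x y -> 0 < weight G x y.
Proof. by case/and3P=> _ _; exact: weight_gt0. Qed.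

Definition induced G C : wgraph R V :=
  WGraph (induced_sym G C) (induced_irr G C) (weight_sym G)
         (@induced_gt0 G C).

Definition connected_graph G : Prop :=
  (0 < #|V|)%N /\ forall u v, connect (adj G) u v.

Definition path_weight G (u : V) (p : seq V) : R :=
  \sum_(e <- zip (u :: p) p) weight G e.1 e.2.

(* The value is +oo when u and v lie in different components. *)
Definition graph_dist G (u v : V) : \bar R :=
  ereal_inf [set (path_weight G u p)%:E |
             p in [set p | path (adj G) u p /\ last u p = v]]%classic.

Definition gball G (v : V) (r : R) : {set V} :=
  [set u | (graph_dist G v u <= r%:E)%E].

Definition doubling_dim G (d : R) : Prop :=
  forall (v : V) (r : R), 0 < r ->
    exists S : {set V}, (#|S|%:R <= 2 `^ d) /\
      gball G v r \subset \bigcup_(s in S) gball G s (r / 2).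

(* The hierarchy starts at the scale mu ^ 0 = 1 with singletons, so distances
   have to be normalized: if two vertices were at distance at most 1 / rho, no
   singleton could contain the ball of radius mu ^ 0 / rho around them. *)
Definition normalized_graph G : Prop :=
  forall u v : V, u != v -> (1 <= graph_dist G u v)%E.

Definition strong_diameter G C : \bar R :=
  \big[maxe/0%E]_(uv in finset.setX C C) graph_dist (induced G C) uv.1 uv.2.

(* A hierarchical partition is the list [:: P_0; ...; P_imax]. Scales beyond
   imax are given the one-cluster partition. *)
Definition scale_partition P (i : nat) : {set {set V}} := nth [set [set: V]] P i.

Definition is_HP G (mu : R) P : Prop :=
  [/\ (0 < size P)%N /\
      forall i, (i < size P)%N -> finset.partition (scale_partition P i) [set: V],
      forall C, C \in scale_partition P 0 -> #|C| = 1%N,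
      scale_partition P (size P).-1 = [set [set: V]],
      forall i C, (i < size P)%N -> C \in scale_partition P i ->
        (strong_diameter G C <= (mu ^+ i)%:E)%E
    & forall i C, (i.+1 < size P)%N -> C \in scale_partition P i.+1 ->
        exists Q : {set {set V}}, Q \subset scale_partition P i /\ C = finset.cover Q].

(* [C] is a cluster of scale [i.+1]. *)
Definition children P (i : nat) C : {set {set V}} :=
  [set D in scale_partition P i | D \subset C].

Definition cluster_degree P (i : nat) C : nat := #|children P i C|.

Definition is_HPF G (rho mu : R) (F : seq (seq {set {set V}})) : Prop :=
  (forall P, P \in F -> is_HP G mu P) /\
  forall (v : V) (i : nat), exists P C,
    [/\ P \in F, C \in scale_partition P i & gball G v (mu ^+ i / rho) \subset C].

End Graph.

Section Asymptotics.
Variable R : realType.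
Implicit Types f g : R -> R.

Definition is_bigO f g : Prop :=
  exists c : R, forall d, 0 <= d -> `|f d| <= c * `|g d|.

(* The truncation at 1 only matters where g < 1, where g (log g)^k would be
   degenerate. *)
Definition is_tildeO f g : Prop :=
  exists (c : R) (k : nat), forall d, 0 <= d ->
    `|f d| <= c * Num.max 1 `|g d| * (1 + ln (Num.max 1 `|g d|)) ^+ k.

End Asymptotics.

(* Main.v *)
(** The hierarchies are built bottom-up. At scale [i.+1] take a net of
    separation [mu ^ i.+1 / 16] and colour it with [2 ^ O(d)] colours so that
    net points of the same colour are [mu ^ i.+1 / 2] apart; the [j]-th
    hierarchy of the family only has to preserve the balls around the net points
    of colour [j]. Every scale-[i] cluster touching such a ball is given to its
    centre, further seeds are added until each vertex is within
    [D = mu ^ i] of a seeded cluster, and the remaining scale-[i] clusters are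
    distributed among the seeds in [O(d log mu)] phases.

    In a phase each seed [t] draws a geometric handicap of at most
    [h = O(d log mu)] units of [2 D], and competes for a vertex [x] with its
    handicap plus its distance to [x] through unassigned clusters. An unassigned
    cluster joins the winner at one of its vertices if it wins there by a margin
    of at least [2 D]. The margin does not decrease along a shortest path to the
    winner, so the enlarged region keeps a strong radius, at the cost of an
    additive [O(h D)] per phase; and it exceeds the diameter of a cluster, so
    that no cluster is claimed twice. A fixed cluster remains unassigned in a
    phase with probability at most 3/4, and its fate depends only on the draws
    of the [mu ^ O(d)] seeds nearby. By the Lovasz local lemma some outcome
    leaves nothing unassigned. The total detour is [O(d^2 log^2 mu) D], which is
    at most [mu D / 4] for a suitable [mu = O(d^3)]. Seeds are [D]-separated,
    and packing bounds the degrees. *)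

Require Import Defs.
From HB Require Import structures.
From mathcomp Require Import all_boot all_order all_algebra.
From mathcomp Require Import all_classical all_reals all_analysis.
From mathcomp Require Import ring lra zify fintype finset.

Set Implicit Arguments.
Unset Strict Implicit.
Unset Printing Implicit Defensive.
Import Order.TTheory GRing.Theory Num.Theory.
Local Open Scope ring_scope.

(** * Bounded paths and packing *)

(** Bounded walks inside G[[S]] replace the extended-real infimum [graph_dist]. The two are
    exchanged only through [graph_dist_le], [graph_dist_leT] and, with a strict loss in the radius,
    [graph_dist_lt]. *)
Definition reach {R : realType} {V : finType} (G : wgraph R V) (S : {set V})
    (r : R) (u v : V) : Prop :=
  exists p, [/\ path (induced_adj G S) u p, last u p = v
              & path_weight G u p <= r].

Lemma card_bigcup_le (I T : finType) (A : {set I}) (f : I -> {set T}) :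
  (#|\bigcup_(i in A) f i| <= \sum_(i in A) #|f i|)%N.
Proof.
elim/big_rec2: _ => [|i m B _ IH]; first by rewrite cards0.
by apply: leq_trans (leq_card_setU _ _) _; rewrite leq_add2l.
Qed.

Section Near.
Context {R : realType} {V : finType} (G : wgraph R V).
Implicit Types (S : {set V}) (r : R) (u v x y : V).

Lemma path_weight_cons u x p :
  path_weight G u (x :: p) = weight G u x + path_weight G x p.
Proof. by rewrite /path_weight /= big_cons. Qed.

Lemma path_weight_nil u : path_weight G u [::] = 0.
Proof. by rewrite /path_weight /= big_nil. Qed.

Lemma path_weight_cat u p q :
  path_weight G u (p ++ q) = path_weight G u p + path_weight G (last u p) q.
Proof.
elim: p u => [|x p IHp] u /=; first by rewrite path_weight_nil add0r.
by rewrite !path_weight_cons IHp addrA.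
Qed.

Lemma path_weight_ge0 S u p :
  path (induced_adj G S) u p -> 0 <= path_weight G u p.
Proof.
elim: p u => [|x p IHp] u /=; first by rewrite path_weight_nil.
case/andP=> /induced_gt0 w0 /IHp; rewrite path_weight_cons; lra.
Qed.

Lemma reach_refl S r u : 0 <= r -> reach G S r u u.
Proof. by move=> r0; exists [::]; rewrite path_weight_nil. Qed.

Lemma reach_ge0 S r u v : reach G S r u v -> 0 <= r.
Proof. by case=> p [/path_weight_ge0 + _]; exact: le_trans. Qed.

Lemma reach_le S r r' u v : r <= r' -> reach G S r u v -> reach G S r' u v.
Proof.
by move=> rr' [p [pP lP wP]]; exists p; split=> //; apply: le_trans rr'.
Qed.

Lemma reach_trans S r r' u v x :
  reach G S r u v -> reach G S r' v x -> reach G S (r + r') u x.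
Proof.
case=> [p [pP lP wP]] [q [qP lQ wQ]]; exists (p ++ q).
by rewrite cat_path pP lP qP last_cat lP lQ path_weight_cat lP lerD.
Qed.

Lemma reach_edge S u v : induced_adj G S u v -> reach G S (weight G u v) u v.
Proof.
move=> uv; exists [:: v]; split=> //=; first by rewrite uv.
by rewrite path_weight_cons path_weight_nil addr0.
Qed.

Lemma reach_sym S r u v : reach G S r u v -> reach G S r v u.
Proof.
case=> [p [pP <- wP]]; apply: reach_le wP _.
elim: p u pP => [|x p IHp] u /=.
  by move=> _; rewrite path_weight_nil; apply: reach_refl.
case/andP=> ux /IHp xP; rewrite path_weight_cons addrC.
apply: reach_trans xP _; rewrite weight_sym; apply: reach_edge.
by rewrite induced_sym.
Qed.

Lemma reach_cons S r u x v : induced_adj G S u x -> reach G S r x v ->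
  reach G S (weight G u x + r) u v.
Proof. by move=> /reach_edge; apply: reach_trans. Qed.

(* The comparison of [S] and [S'] is only needed where the path can go. *)
Lemma reach_local S S' r u v :
  (forall x, reach G [set: V] r u x -> x \in S -> x \in S') ->
  reach G S r u v -> reach G S' r u v.
Proof.
move=> + [p [pP <- wP]]; elim: p u r pP wP => [|x p IHp] u r /=.
  by rewrite path_weight_nil => _ r0 _; apply: reach_refl.
case/andP=> ux xp; rewrite path_weight_cons => wP SS'.
have w0 := path_weight_ge0 xp.
have [uS xS uxG] := and3P ux.
have uxT : induced_adj G [set: V] u x by rewrite /induced_adj /= !inE.
have -> : r = weight G u x + (r - weight G u x) by lra.
apply: reach_cons.
  apply/and3P; split=> //; apply: SS' => //.
    by apply: reach_refl; move: (weight_gt0 uxG); lra.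
  by apply: reach_le (reach_edge uxT); lra.
apply: IHp => //; first lra.
move=> y xy; apply: SS'.
have -> : r = weight G u x + (r - weight G u x) by lra.
exact: reach_cons xy.
Qed.

Lemma reach_sub S S' r u v : S \subset S' -> reach G S r u v -> reach G S' r u v.
Proof. by move=> /subsetP SS'; apply: reach_local => x _; apply: SS'. Qed.

Lemma reachT S r u v : reach G S r u v -> reach G [set: V] r u v.
Proof. by apply: reach_sub; rewrite subsetT. Qed.

Lemma induced_adjT : induced_adj G [set: V] =2 adj G.
Proof. by move=> x y; rewrite /induced_adj /= !inE. Qed.

Lemma graph_dist_le S r u v :
  reach G S r u v -> (graph_dist (Defs.induced G S) u v <= r%:E)%E.
Proof.
case=> [p [pP lP wP]]; apply: ereal_inf_le.
exists (path_weight G u p)%:E; last by rewrite lee_fin.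
by exists p.
Qed.

Lemma graph_dist_leT r u v :
  reach G [set: V] r u v -> (graph_dist G u v <= r%:E)%E.
Proof.
case=> [p [pP lP wP]]; apply: ereal_inf_le.
exists (path_weight G u p)%:E; last by rewrite lee_fin.
by exists p => //; split=> //; rewrite -(eq_path induced_adjT).
Qed.

Lemma graph_dist_lt r r' u v :
  (graph_dist G u v <= r%:E)%E -> r < r' -> reach G [set: V] r' u v.
Proof.
move=> duv rr'.
have : (graph_dist G u v < r'%:E)%E by apply: le_lt_trans duv _; rewrite lte_fin.
case/ereal_inf_lt=> _ [p [pP lP] <-]; rewrite lte_fin => /ltW wP.
by exists p; split=> //; rewrite (eq_path induced_adjT).
Qed.

Lemma connected_reach : connected_graph G ->
  exists2 r, 0 <= r & forall u v, reach G [set: V] r u v.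
Proof.
case=> _ cG.
have nP u v : exists r, reach G [set: V] r u v.
  have /connectP[p pP ->] := cG u v.
  by exists (path_weight G u p), p; rewrite (eq_path induced_adjT).
have /boolp.choice[f fP] : forall uv : V * V, exists r, reach G [set: V] r uv.1 uv.2.
  by move=> uv; apply: nP.
exists (\sum_uv f uv) => [|u v].
  by apply: sumr_ge0 => uv _; apply: reach_ge0 (fP uv).
apply: reach_le (fP (u, v)).
rewrite (bigD1 (u, v)) //= lerDl sumr_ge0 // => uv _.
exact: reach_ge0 (fP uv).
Qed.

Definition doubling_bound (K : nat) : Prop :=
  forall v r, 0 < r -> exists S : {set V}, (#|S| <= K)%N /\
    gball G v r \subset \bigcup_(s in S) gball G s (r / 2).

Lemma doubling_iter K k v r : doubling_bound K -> 0 < r ->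
  exists S : {set V}, (#|S| <= K ^ k)%N /\
    gball G v r \subset \bigcup_(s in S) gball G s (r / 2 ^+ k).
Proof.
move=> dK r0; elim: k => [|k [S [SK SP]]].
  exists [set v]; rewrite cards1; split=> //.
  by rewrite big_set1 expr0 divr1.
have rk : 0 < r / 2 ^+ k by rewrite divr_gt0 // exprn_gt0.
have /boolp.choice[f fP] : forall s, exists S : {set V}, (#|S| <= K)%N /\
    gball G s (r / 2 ^+ k) \subset \bigcup_(x in S) gball G x (r / 2 ^+ k / 2).
  by move=> s; apply: dK.
exists (\bigcup_(s in S) f s); split.
  apply: leq_trans (card_bigcup_le _ _) _ => //.
  rewrite expnSr; apply: leq_trans (leq_mul SK (leqnn K)).
  by rewrite -sum_nat_const; apply: leq_sum => s _; case: (fP s).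
apply: subset_trans SP _; apply/subsetP => x /bigcupP[s sS xs].
have [_ /subsetP/(_ x xs)/bigcupP[y ys xy]] := fP s.
apply/bigcupP; exists y; first by apply/bigcupP; exists s.
by rewrite exprSr invfM mulrA.
Qed.

(** After [k] halvings each point of [X] lies in one of [K ^ k] balls of radius [r / 2 ^+ k], and
    the separation allows at most one point of [X] per ball. *)
Lemma packing K k (X : {set V}) v (r sep : R) : doubling_bound K ->
  0 < r -> 2 * (r / 2 ^+ k) < sep ->
  (forall x, x \in X -> reach G [set: V] r v x) ->
  {in X &, forall x y, reach G [set: V] sep x y -> x = y} ->
  (#|X| <= K ^ k)%N.
Proof.
move=> dK r0 rsep Xv Xsep.
have [S [SK /subsetP SP]] := doubling_iter k v dK r0.
have /boolp.choice[f fP] : forall x, exists s, x \in X ->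
    s \in S /\ x \in gball G s (r / 2 ^+ k).
  move=> x; case: (boolP (x \in X)) => xX; last by exists x.
  have /SP/bigcupP[s sS xs] : x \in gball G v r.
    by rewrite inE; apply/graph_dist_leT/Xv.
  by exists s.
apply: leq_trans SK.
rewrite -(card_in_imset (f := f) (D := X)); last first.
  move=> x y xX yX fxy; apply: Xsep => //.
  have [_] := fP x xX; have [_] := fP y yX; rewrite -fxy !inE => dy dx.
  have -> : sep = sep / 2 + sep / 2 by lra.
  by apply: reach_trans; [apply: reach_sym|]; apply: graph_dist_lt; eauto; lra.
apply: subset_leq_card; apply/subsetP => _ /imsetP[x xX ->].
by have [] := fP x xX.
Qed.

End Near.

(** * The symmetric local lemma on finite product spaces *)

Section LocalLemma.
Context {V B : finType}.
Local Notation Om := {ffun V -> B}.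
Implicit Types (E F : {set Om}) (S : {set V}).

Definition depends_on S E : Prop :=
  forall w w' : Om, {in S, w =1 w'} -> w \in E -> w' \in E.

Definition mix S (w w' : Om) : Om := [ffun v => if v \in S then w v else w' v].

(* [(w, w') |-> (mix S w w', mix S w' w)] is an involution of [Om * Om]
   exchanging [E x F] with [(E :&: F) x Om]. *)
Lemma card_indep S E F : depends_on S E -> depends_on (~: S) F ->
  (#|E :&: F| * #|{: Om}| = #|E| * #|F|)%N.
Proof.
move=> dE dF; rewrite -[#|{: Om}|]cardsT -!cardsX.
pose phi (ww : Om * Om) := (mix S ww.1 ww.2, mix S ww.2 ww.1).
have phiK : involutive phi.
  by case=> w w'; rewrite /phi /=; congr (_, _); apply/ffunP => v;
    rewrite !ffunE; case: (v \in S).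
rewrite -(card_imset _ (inv_inj phiK)); apply: eq_card => -[w w'].
apply/imsetP/idP => [[[u u'] + ->]|].
  rewrite !inE /= => /andP[/andP[uE uF] _]; apply/andP; split.
    by apply: dE uE => v vS; rewrite ffunE vS.
  by apply: dF uF => v; rewrite inE ffunE => /negPf->.
rewrite inE /= => /andP[wE wF]; exists (phi (w, w')); last by rewrite phiK.
rewrite !inE andbT /=; apply/andP; split.
  by apply: dE wE => v vS; rewrite ffunE vS.
by apply: dF wF => v; rewrite inE ffunE => /negPf->.
Qed.

(** Probabilities are ratios of cardinals in the uniform product space: [prE] bounds each of them by
    1/K, and [degE] bounds the number of events sharing a coordinate with a given one. *)
Context {I : finType} (E : I -> {set Om}) (S : I -> {set V}) (K D : nat).
Hypothesis dE : forall x, depends_on (S x) (E x).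
Hypothesis prE : forall x, (K * #|E x| <= #|{: Om}|)%N.
Hypothesis degE : forall x, (#|[set y | ~~ [disjoint S x & S y]]| <= D)%N.
Hypothesis KD : (4 * D <= K)%N.
Hypothesis K4 : (4 <= K)%N.

Definition avoid (Y : {set I}) : {set Om} := \bigcap_(y in Y) ~: E y.

Lemma depends_avoid (Y : {set I}) (T : {set V}) :
  {in Y, forall y, S y \subset T} -> depends_on T (avoid Y).
Proof.
move=> YT w w' ww' /bigcapP wY; apply/bigcapP => y yY.
have := wY _ yY; rewrite !inE; apply: contra; apply: dE => v vS.
by rewrite ww' // (subsetP (YT y yY)).
Qed.

Lemma avoid_setU (Y Z : {set I}) : avoid (Y :|: Z) = avoid Y :&: avoid Z.
Proof. by rewrite /avoid bigcap_setU. Qed.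

(** By induction on [Y], the conditional probability of [E x] given [avoid Y] is at most 2/K. [E x]
    is independent of the part [Y2] of [Y] sharing no coordinate with it, and by induction the at
    most [D] other events take away at most half of [avoid Y2]. *)
Lemma local_lemma_cond n (Y : {set I}) x : (#|Y| <= n)%N ->
  (K * #|E x :&: avoid Y| <= 2 * #|avoid Y|)%N.
Proof.
have [Om0|Om0] := posnP #|{: Om}|.
  have -> : #|E x :&: avoid Y| = 0%N.
    by apply/eqP; rewrite -leqn0 -Om0 max_card.
  by rewrite muln0.
elim: n Y x => [|n IHn] Y x Yn.
  have -> : Y = set0 by apply/eqP; rewrite -cards_eq0 -leqn0.
  rewrite /avoid big_set0 setIT cardsT.
  by rewrite mul2n -addnn (leq_trans (prE x)) ?leq_addr.
pose Y1 := [set y in Y | ~~ [disjoint S x & S y]].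
pose Y2 := Y :\: Y1.
have Y12 : Y = Y1 :|: Y2.
  apply/setP => y; rewrite !inE.
  by case: (y \in Y) => /=; case: [disjoint S x & S y].
have E2 : (K * #|E x :&: avoid Y2| <= #|avoid Y2|)%N.
  have : depends_on (~: S x) (avoid Y2).
    apply: depends_avoid => y; rewrite !inE => /andP[+ yY]; rewrite yY /= negbK.
    by rewrite disjoint_sym -disjoints_subset.
  move/(card_indep (dE (x := x))) => indep.
  rewrite -(leq_pmul2r Om0) -mulnA indep mulnA [leqRHS]mulnC.
  by rewrite leq_mul2r prE orbT.
have [Y10|[z zY1]] := set_0Vmem Y1.
  rewrite Y12 Y10 set0U (leq_trans E2) //.
  by rewrite mul2n -addnn leq_addr.
have Y2n : (#|Y2| <= n)%N.
  rewrite -ltnS; apply: leq_trans Yn; apply: proper_card.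
  rewrite /Y2 properEneq subsetDl andbT; apply/eqP => YY.
  move: (zY1); have : z \in Y by move: zY1; rewrite inE => /andP[].
  by rewrite -{1}YY inE => /andP[/negPf->].
have E1 : (\sum_(y in Y1) K * #|E y :&: avoid Y2| <= D * (2 * #|avoid Y2|))%N.
  apply: (@leq_trans (\sum_(y in Y1) 2 * #|avoid Y2|)%N).
    by apply: leq_sum => y _; apply: IHn.
  rewrite sum_nat_const leq_mul2r (leq_trans _ (degE x)) ?orbT //.
  by apply: subset_leq_card; apply/subsetP => y; rewrite !inE => /andP[].
have cov : (#|avoid Y2| <= #|avoid Y| + \sum_(y in Y1) #|E y :&: avoid Y2|)%N.
  have /subset_leq_card/leq_trans : avoid Y2 \subset
      avoid Y :|: \bigcup_(y in Y1) (E y :&: avoid Y2).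
    apply/subsetP => w w2; rewrite inE orbC -implyNb; apply/implyP => wE.
    rewrite Y12 avoid_setU inE w2 andbT; apply/bigcapP => y yY1.
    rewrite inE; apply: contra wE => wy.
    by apply/bigcupP; exists y; rewrite // inE wy.
  apply; apply: leq_trans (leq_card_setU _ _) _.
  by rewrite leq_add2l card_bigcup_le.
have E3 : (#|E x :&: avoid Y| <= #|E x :&: avoid Y2|)%N.
  by apply: subset_leq_card; rewrite Y12 avoid_setU setIS // subsetIr.
move: E1; rewrite -big_distrr /=; move: cov E2 E3 KD K4.
move: (\sum_(y in Y1) _)%N #|avoid Y2| #|avoid Y| #|E x :&: avoid Y|
  #|E x :&: avoid Y2| => s a2 a e e2.
by nia.
Qed.

(** The events are avoided one after another; each leaves at least a fraction 1 - 2/K, hence half,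
    of the remaining outcomes. *)
Theorem local_lemma : (0 < #|{: Om}|)%N -> exists w, forall x, w \notin E x.
Proof.
move=> Om0; suff: (0 < #|avoid [set x in enum I]|)%N.
  case/card_gt0P => w /bigcapP wP; exists w => x.
  by have := wP x; rewrite !inE mem_enum; apply.
elim: (enum I) => [|x s IHs].
  by rewrite /avoid big_pred0 ?cardsT // => x; rewrite inE.
have := local_lemma_cond x (leqnn #|[set y in s]|).
have -> : [set y in x :: s] = [set x] :|: [set y in s].
  by apply/setP => y; rewrite !inE.
have a1 : avoid [set x] = ~: E x by rewrite /avoid big_set1.
rewrite avoid_setU a1 [~: E x :&: _]setIC -setDE [E x :&: _]setIC.
have := cardsID (E x) (avoid [set y in s]); move: IHs K4.
move: #|avoid [set y in s]| #|_ :&: _| #|_ :\: _| => a e f; nia.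
Qed.

End LocalLemma.

(** * One phase of cluster aggregation *)

(** On a uniform element of ['I_(2 ^ h)] this is a truncated geometric variable: it equals j > 0
    with probability 2^(j-1-h). *)
Definition bitlen (b : nat) : nat := if b is 0 then 0%N else (trunc_log 2 b).+1.

Lemma bitlen_half b : (0 < b)%N -> bitlen b = (bitlen b./2).+1.
Proof. by case: b => [|[|b]] // _; rewrite /bitlen trunc_log2S. Qed.

Lemma bitlen_le b h : (b < 2 ^ h)%N -> (bitlen b <= h)%N.
Proof.
case: b => [|b] // bh; rewrite /bitlen -(ltn_exp2l _ _ (ltnSn 1)).
by apply: leq_ltn_trans bh; apply: trunc_logP.
Qed.

Section Phase.
Context {R : realType} {V : finType} (G : wgraph R V).
Variables (c : V -> V) (D : R) (h : nat).
Implicit Types (st : V -> option V) (b : V -> 'I_(2 ^ h)) (x y t : V) (r : R).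

(* A partition is encoded by a map [c] that is constant exactly on its clusters.
   The state [st] of the aggregation sends a vertex to the seed of its region,
   or to [None] as long as it is unassigned. *)
Definition cluster x : {set V} := [set y | c y == c x].

Hypothesis D0 : 0 < D.
Hypothesis cluster_reach : forall x y, c x = c y -> reach G (cluster x) D x y.

(* The truncation of distances at [cap] makes them depend on the state within a
   bounded radius only; [cap] exceeds any value that can win a phase. *)
Definition cap : R := D * (2 * h%:R + 4).
Definition part st t : {set V} := [set x | st x == Some t].
Definition region st t : {set V} := [set x | (st x == None) || (st x == Some t)].

Definition dist_set st t x : set R := [set r | 0 <= r /\
  (cap <= r \/ exists2 v, st v = Some t & reach G (region st t) r x v)]%classic.

Definition dist st t x : R := inf (dist_set st t x).

Lemma cap_gt0 : 0 < cap.
Proof. by rewrite mulr_gt0 // ltr_wpDl // mulr_ge0. Qed.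

Lemma dist_le st t x r : dist_set st t x r -> dist st t x <= r.
Proof. by apply: ge_inf; exists 0 => s []. Qed.

Lemma dist_set_cap st t x : dist_set st t x cap.
Proof. by split; [apply/ltW/cap_gt0|left]. Qed.

Lemma dist_ge st t x r :
  (forall s, dist_set st t x s -> r <= s) -> r <= dist st t x.
Proof. by apply: lb_le_inf; exists cap; apply: dist_set_cap. Qed.

Lemma dist_ge0 st t x : 0 <= dist st t x.
Proof. by apply: dist_ge => r []. Qed.

Lemma dist_cap st t x : dist st t x <= cap.
Proof. exact/dist_le/dist_set_cap. Qed.

Lemma dist_part st t x : st x = Some t -> dist st t x = 0.
Proof.
move=> xt; apply/eqP; rewrite eq_le dist_ge0 andbT; apply: dist_le; split=> //.
by right; exists x => //; apply: reach_refl.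
Qed.

Lemma dist_lipschitz st t r x y : reach G (region st t) r x y ->
  dist st t x <= r + dist st t y.
Proof.
move=> xy; rewrite -lerBlDl; apply: dist_ge => s [s0 sP]; rewrite lerBlDl.
have r0 := reach_ge0 xy.
apply: dist_le; split; first by rewrite addr_ge0.
case: sP => [cs|[v vt yv]]; first by left; lra.
by right; exists v => //; apply: reach_trans xy yv.
Qed.

Lemma dist_reach st t x : dist st t x < cap ->
  exists2 v, st v = Some t & reach G (region st t) cap x v.
Proof.
case/inf_lt => [|r [_ []]]; first by exists cap; apply: dist_set_cap.
  by move=> cr /(le_lt_trans cr); rewrite ltxx.
by move=> [v vt xv] /ltW rc; exists v => //; apply: reach_le xv.
Qed.

(** Comparing the infimum with a minimum over the finitely many neighbours gives an exact first
    step; the default [cap] of the minimum is excluded by [dist st t x < cap]. *)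
Lemma dist_descent st t x : st x = None -> dist st t x < cap ->
  exists y, [/\ induced_adj G (region st t) x y, dist st t y < dist st t x
              & weight G x y + dist st t y <= dist st t x].
Proof.
move=> xN xcap.
have : \big[Num.min/cap]_(y | induced_adj G (region st t) x y)
    (weight G x y + dist st t y) <= dist st t x.
  apply: dist_ge => r [r0 [|[v vt [p [pP vE pw]]]]].
    by apply: le_trans; apply: bigmin_le_id.
  case: p pP vE pw => [_ vE|y p] /=; first by rewrite -vE xN in vt.
  case/andP=> xy yp vE; rewrite path_weight_cons => pw.
  apply: (bigmin_inf y) => //; apply: le_trans pw; rewrite lerD2l.
  apply: dist_le; split; first exact: path_weight_ge0 yp.
  by right; exists v => //; exists p.
case/bigmin_leP => [|[y xy yw]]; first by rewrite leNgt xcap.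
exists y; split=> //.
by move: (induced_gt0 xy); lra.
Qed.

Definition cost st b t x : R := dist st t x + 2 * D * (bitlen (b t))%:R.

(** Only rivals within [cap] are compared, so that membership in the core depends on nearby seeds;
    [coreP] extends the margin to all rivals. *)
Definition core st b t x : bool := (dist st t x < cap) &&
  [forall t', (t' != t) && (dist st t' x < cap) ==>
              (cost st b t x + 2 * D <= cost st b t' x)].

Definition touch st b t x : bool := [exists y, (c y == c x) && core st b t y].

Definition step st b x : option V :=
  if st x is Some t then Some t else [pick t | touch st b t x].

(** [rho] bounds the strong radius of the regions. The last clause provides each vertex with a seed
    at [dist] at most [D], which bounds the cost of a winner. *)
Definition invariant rho st : Prop :=
  [/\ forall x y, c x = c y -> st x = st y,
      forall x t, st x = Some t -> reach G (part st t) rho x t,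
      forall x t, st x = Some t -> st t = Some t
    & forall x, exists2 y, st y <> None & reach G [set: V] D x y].

Lemma cost_le st b t x : cost st b t x <= dist st t x + 2 * D * h%:R.
Proof.
rewrite lerD2l ler_wpM2l ?ler_nat ?bitlen_le //.
by rewrite mulr_ge0 // ltW.
Qed.

Lemma cost_ge st b t x : dist st t x <= cost st b t x.
Proof. by rewrite lerDl !mulr_ge0 // ltW. Qed.

(** The walk is cut at its first assigned vertex: all earlier ones are unassigned, so this piece
    lies in the region of the seed found there. *)
Lemma dist_near st x : (exists2 y, st y <> None & reach G [set: V] D x y) ->
  exists2 t, x \in region st t & dist st t x <= D.
Proof.
case=> y yN [p [pP yE pw]].
elim: p x D pP yE pw => [|z p IHp] x r /=.
  move=> _ xy; rewrite path_weight_nil -xy in yN * => r0.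
  case xt: (st x) yN => [t|//] _; exists t; first by rewrite inE xt eqxx orbT.
  by rewrite dist_part.
case/andP=> xz zp yE; rewrite path_weight_cons => pw.
have w0 := induced_gt0 xz.
case xt: (st x) => [t|].
  exists t; first by rewrite inE xt eqxx orbT.
  by rewrite dist_part //; move: (path_weight_ge0 zp); lra.
have [|t zt zr] := IHp z (r - weight G x z) zp yE; first lra.
have xR : x \in region st t by rewrite inE xt.
exists t => //; have /dist_lipschitz : reach G (region st t) (weight G x z) x z.
  by apply: reach_edge; apply/and3P; split=> //; case/and3P: xz.
by move=> /le_trans; apply; lra.
Qed.

(** * Effect of one phase on the regions *)

Section Invariant.
Variables (rho : R) (st : V -> option V).
Hypothesis inv : invariant rho st.

Let st_c x y : c x = c y -> st x = st y. Proof. by case: inv => + _ _ _; apply. Qed.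

Lemma exists_dist_le x : exists2 t, x \in region st t & dist st t x <= D.
Proof. by apply: dist_near; case: inv => _ _ _; apply. Qed.

(** Some seed costs at most [D + 2 * D * h], and adding the margin stays below [cap]; a rival
    truncated at [cap] is thus beaten by the margin. *)
Lemma coreP b t x : reflect
  (forall t', t' != t -> cost st b t x + 2 * D <= cost st b t' x) (core st b t x).
Proof.
have D1 := D0; have capE : cap = 2 * D * h%:R + 4 * D by rewrite /cap; ring.
have h0 : 0 <= 2 * D * h%:R by rewrite !mulr_ge0 // ltW.
apply: (iffP andP) => [[tc /forallP tP] t' t't|tP];
  have [s _ sD] := exists_dist_le x; have sV := cost_le st b s x.
  case: (ltP (dist st t' x) cap) => [t'c|ct'].
    by move: (tP t'); rewrite t't t'c; apply.
  have ts : cost st b t x <= cost st b s x.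
    case: (eqVneq s t) => [->//|st'].
    have sc : dist st s x < cap by lra.
    by move: (tP s); rewrite st' sc /=; lra.
  by have := cost_ge st b t' x; lra.
split; last by apply/forallP => t'; apply/implyP => /andP[/tP].
apply: le_lt_trans (cost_ge st b t x) _.
case: (eqVneq s t) => [<-|/tP]; lra.
Qed.

Lemma core_dist b t x : core st b t x -> dist st t x <= D + 2 * D * h%:R.
Proof.
move=> /coreP tP; have D1 := D0; have [s _ sD] := exists_dist_le x.
have sV := cost_le st b s x; apply: le_trans (cost_ge st b t x) _.
case: (eqVneq s t) => [<-|/tP]; lra.
Qed.

Lemma core_uniq b t t' x : core st b t x -> core st b t' x -> t = t'.
Proof.
move=> /coreP tP /coreP t'P; apply/eqP; apply: contraT => tt'; have D1 := D0.
have := tP t'; rewrite eq_sym => /(_ tt'); have := t'P t tt'; lra.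
Qed.

Lemma cluster_dist t x y : c x = c y -> st x = None ->
  dist st t x <= D + dist st t y.
Proof.
move=> cxy xN; apply/dist_lipschitz/reach_sub/cluster_reach => //.
by apply/subsetP => z; rewrite !inE => /eqP/st_c->; rewrite xN.
Qed.

(** From [y] to [z] inside the cluster each [dist] changes by at most [D], so the difference of two
    costs by at most [2 * D]; opposite margins at [y] and [z] would change it by at least
    [4 * D]. *)
Lemma touch_uniq b t t' x : st x = None ->
  touch st b t x -> touch st b t' x -> t = t'.
Proof.
move=> xN /existsP[y /andP[/eqP cy /coreP ty]] /existsP[z /andP[/eqP cz /coreP tz]].
apply/eqP; apply: contraT => tt'; have D1 := D0.
have yN : st y = None by rewrite (st_c cy).
have zN : st z = None by rewrite (st_c cz).
have := ty t'; rewrite eq_sym => /(_ tt'); have := tz t tt'.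
have := cluster_dist t (etrans cz (esym cy)) zN.
have := cluster_dist t' (etrans cy (esym cz)) yN.
by rewrite /cost; lra.
Qed.

Lemma step_touch b t x : st x = None -> touch st b t x -> step st b x = Some t.
Proof.
move=> xN xt; rewrite /step xN; case: pickP => [t' xt'|/(_ t)]; last by rewrite xt.
by rewrite (touch_uniq xN xt xt').
Qed.

Lemma step_mono b t x : st x = Some t -> step st b x = Some t.
Proof. by rewrite /step => ->. Qed.

Lemma step_c b x y : c x = c y -> step st b x = step st b y.
Proof.
move=> cxy; rewrite /step (st_c cxy); case: (st y) => //.
by apply: eq_pick => t; rewrite /touch cxy.
Qed.

(** Towards [t] the cost of [t] falls by at least the edge weight, that of a rival by at most as
    much. *)
Lemma core_descent b t x y : st x = None -> core st b t x ->
  induced_adj G (region st t) x y ->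
  weight G x y + dist st t y <= dist st t x -> st y = None ->
  core st b t y.
Proof.
move=> xN /coreP xt xy w yN; apply/coreP => t' tt'.
have /dist_lipschitz : reach G (region st t') (weight G x y) x y.
  apply: reach_edge; apply/and3P; rewrite !inE xN yN; split=> //.
  by case/and3P: xy.
by move: (xt t' tt'); rewrite /cost; lra.
Qed.

(** The descent towards [t] stays in the core of [t] until it meets the old region, so all its
    vertices join [t]. The induction is on the number of vertices with smaller [dist]. *)
Lemma core_reach b t x : st x = None -> core st b t x ->
  exists2 v, st v = Some t & reach G (part (step st b) t) (dist st t x) x v.
Proof.
have [n] := ubnP #|[set z | dist st t z < dist st t x]|.
elim: n x => // n IHn x xn xN xt.
have xc : dist st t x < cap by case/andP: xt.
have [y [xy yx w]] := dist_descent xN xc.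
have xP : x \in part (step st b) t.
  rewrite inE (@step_touch b t x) //; apply/existsP; exists x; by rewrite eqxx.
have xyG : adj G x y by case/and3P: xy.
have := xy => /and3P[_]; rewrite inE => /orP[]/eqP yS _; last first.
  exists y => //.
  apply: (@reach_le _ _ _ _ (weight G x y)); first by rewrite dist_part // addr0 in w.
  by apply: reach_edge; rewrite /induced_adj /= xP inE (step_mono b yS) eqxx.
have yt := core_descent xN xt xy w yS.
have yP : y \in part (step st b) t.
  rewrite inE (@step_touch b t y) //; apply/existsP; exists y; by rewrite eqxx.
have [|v vt yv] := IHn y _ yS yt.
  rewrite -ltnS; apply: leq_trans xn; rewrite ltnS; apply: proper_card.
  apply/properP; split; first by apply/subsetP => z; rewrite !inE => /lt_trans; apply.
  by exists y; rewrite !inE ?ltxx.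
exists v => //; apply: reach_le w _; apply: reach_cons yv.
by rewrite /induced_adj /= xP yP.
Qed.

Lemma step_invariant b : invariant (rho + D * (2 * h%:R + 2)) (step st b).
Proof.
have [_ st_r st_t st_d] := inv.
have sub t : part st t \subset part (step st b) t.
  by apply/subsetP => x; rewrite !inE => /eqP xt; rewrite (step_mono b xt).
split.
- exact: step_c.
- move=> x t; case xs: (st x) => [t'|].
    rewrite (step_mono b xs) => -[<-]; apply: reach_sub (sub t') _.
    apply: reach_le (st_r _ _ xs); rewrite lerDl.
    by rewrite mulr_ge0 ?ltW // ltr_wpDl // mulr_ge0.
  rewrite {1}/step xs; case: pickP => // s xt [<-].
  have /existsP[y /andP[/eqP cy yt]] := xt.
  have yN : st y = None by rewrite (st_c cy).
  have [v vt yv] := core_reach yN yt.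
  (* [D] crosses the joining cluster to its core vertex, [D + 2 * D * h] leads on to the old region,
     and [rho] to the seed. *)
  have -> : rho + D * (2 * h%:R + 2) = D + ((D + 2 * D * h%:R) + rho) by ring.
  apply: (@reach_trans _ _ _ _ _ _ _ y).
    apply: reach_sub (cluster_reach (esym cy)).
    apply/subsetP => z; rewrite !inE => /eqP cz.
    by rewrite (step_c b cz) (step_touch xs xt).
  apply: (@reach_trans _ _ _ _ _ _ _ v).
    exact: reach_le (core_dist yt) yv.
  exact: reach_sub (sub s) (st_r _ _ vt).
- move=> x t; case xs: (st x) => [t'|].
    by rewrite (step_mono b xs) => -[<-]; apply: step_mono; apply: st_t xs.
  rewrite /step xs; case: pickP => // s xt [<-].
  have /existsP[y /andP[_ /andP[/dist_reach[v vt _] _]]] := xt.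
  by rewrite (st_t _ _ vt).
- move=> x; have [y yN xy] := st_d x; exists y => //.
  by case ys: (st y) yN => [t|//] _; rewrite (step_mono b ys).
Qed.

End Invariant.
End Phase.

(** * Iterating the phases *)

Section Aggregation.
Context {R : realType} {V : finType} (G : wgraph R V).
Variables (c : V -> V) (D : R) (h L : nat).
Hypothesis D0 : 0 < D.
Hypothesis cluster_reach : forall x y, c x = c y -> reach G (cluster c x) D x y.
Local Notation B := 'I_(2 ^ h).
Local Notation Om := {ffun V -> {ffun 'I_L.+1 -> B}}.
Local Notation cap := (cap D h).
Local Notation dist := (dist G D h).
Local Notation cost := (cost G D).
Local Notation core := (core G D).
Local Notation step := (step G c D).
Local Notation invariant := (invariant G c D).
Implicit Types (st : V -> option V) (w : Om) (x y t : V).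

Lemma dist_local_le st1 st2 t x :
  (forall z, reach G [set: V] cap x z -> st1 z = st2 z) ->
  dist st1 t x <= dist st2 t x.
Proof.
move=> st12; apply: (dist_ge D0) => s [s0 sP]; apply: dist_le; split=> //.
have [|sc] := leP cap s; first by left.
case: sP => [|[v vt xv]]; first by rewrite leNgt sc.
right; exists v; first by rewrite st12 //; apply/reachT/(reach_le (ltW sc))/xv.
apply: reach_local xv => z xz; rewrite !inE st12 //.
exact: reach_le (ltW sc) xz.
Qed.

Lemma dist_local st1 st2 t x :
  (forall z, reach G [set: V] cap x z -> st1 z = st2 z) ->
  dist st1 t x = dist st2 t x.
Proof.
move=> st12; apply/eqP; rewrite eq_le !dist_local_le // => z xz.
by rewrite st12.
Qed.

Lemma core_local rho st1 st2 (b1 b2 : V -> B) t x : invariant rho st1 ->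
  (forall z, reach G [set: V] cap x z -> st1 z = st2 z) ->
  (forall s, reach G [set: V] (cap + rho) x s -> st1 s = Some s -> b1 s = b2 s) ->
  core st1 b1 t x = core st2 b2 t x.
Proof.
move=> [_ st_r st_t _] st12 b12.
have dE s : dist st1 s x = dist st2 s x by apply: dist_local.
have vE s : dist st2 s x < cap -> cost st1 b1 s x = cost st2 b2 s x.
  move=> sc; rewrite /cost dE b12 //.
    have [v vs xv] : exists2 v, st1 v = Some s & reach G (region st1 s) cap x v.
      by apply: (dist_reach D0); rewrite dE.
    exact: reach_trans (reachT xv) (reachT (st_r _ _ vs)).
  have [v vs xv] : exists2 v, st1 v = Some s & reach G (region st1 s) cap x v.
    by apply: (dist_reach D0); rewrite dE.
  exact: st_t vs.
rewrite /core dE; case: ltP => //= tc; apply: eq_forallb => s.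
by rewrite dE; case: ltP => [sc|]; rewrite ?andbF // !vE.
Qed.

(** One phase reads the state up to distance [cap + D = W], and it increases the radius by less than
    [W]. *)
Let W : R := D * (2 * h%:R + 5).

Lemma W_ge0 : 0 <= W.
Proof. by rewrite mulr_ge0 ?ltW // ltr_wpDl // mulr_ge0. Qed.

Lemma W_cap : W = cap + D.
Proof. by rewrite /W /cap; ring. Qed.

Lemma step_local rho st1 st2 (b1 b2 : V -> B) x : invariant rho st1 ->
  (forall z, reach G [set: V] W x z -> st1 z = st2 z) ->
  (forall s, reach G [set: V] (W + rho) x s -> st1 s = Some s -> b1 s = b2 s) ->
  step st1 b1 x = step st2 b2 x.
Proof.
move=> inv st12 b12.
have W0 := W_ge0.
rewrite /step st12; last exact: reach_refl.
case: (st2 x) => //; apply: eq_pick => t; rewrite /touch; apply: eq_existsb => y.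
case: eqP => //= cyx; have xy := reachT (cluster_reach (esym cyx)).
apply: core_local inv _ _.
  move=> z yz; apply: st12; rewrite W_cap addrC; exact: reach_trans xy yz.
move=> s ys; apply: b12; rewrite W_cap [cap + D]addrC -addrA.
exact: reach_trans xy ys.
Qed.

Lemma step_seed rho st (b : V -> B) x t : invariant rho st ->
  step st b x = Some t -> st t = Some t.
Proof.
case=> _ _ st_t _; case xs: (st x) => [s|].
  by rewrite (step_mono _ _ _ _ xs) => -[<-]; apply: st_t xs.
rewrite /step xs; case: pickP => // s xt [<-].
have /existsP[y /andP[_ /andP[/(dist_reach D0)[v vt _] _]]] := xt.
exact: st_t vt.
Qed.

Variables (st0 : V -> option V) (rho0 : R).
Hypothesis inv0 : invariant rho0 st0.

Fixpoint state w k : V -> option V :=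
  if k is k'.+1 then step (state w k') (fun v => w v (inord k')) else st0.

Lemma state_inv w k : invariant (rho0 + k%:R * W) (state w k).
Proof.
elim: k => [|k IHk] /=; first by rewrite mul0r addr0.
have [c_ r_ t_ d_] := step_invariant D0 cluster_reach IHk (fun v => w v (inord k)).
split=> // x t /r_; apply: reach_le; rewrite -natr1 /W.
by have D1 := D0; lra.
Qed.

Lemma state_seed w k x t : state w k x = Some t -> st0 t = Some t.
Proof.
elim: k x => [|k IHk] x /=; first by case: inv0 => _ _ + _; apply.
by move=> /(step_seed (state_inv w k)); apply: IHk.
Qed.

Lemma state_mono w k x t : st0 x = Some t -> state w k x = Some t.
Proof. by move=> xt; elim: k => //= k /(step_mono _ _ _); apply. Qed.

Lemma state_local k w1 w2 x :
  (forall t, st0 t = Some t ->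
     reach G [set: V] (rho0 + (2 * k)%:R * W) x t -> w1 t = w2 t) ->
  state w1 k x = state w2 k x.
Proof.
have W0 := W_ge0.
elim: k x => [|k IHk] x //= w12.
have k0 : 0 <= k%:R * W by rewrite mulr_ge0.
have kE : (2 * k.+1)%:R * W = W + W + k%:R * W + k%:R * W.
  by rewrite natrM -natr1; ring.
apply: (step_local (state_inv w1 k)).
  move=> z xz; apply: IHk => t tt zt; apply: w12 => //; rewrite kE.
  apply: reach_le (reach_trans xz zt).
  by rewrite natrM; lra.
move=> s xs /state_seed ss; rewrite w12 //; rewrite kE.
by apply: reach_le xs; lra.
Qed.

Lemma state_ext k w1 w2 :
  (forall v i, (i < k)%N -> w1 v (inord i) = w2 v (inord i)) ->
  state w1 k = state w2 k.
Proof.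
elim: k => //= k IHk w12; rewrite IHk => [|v i ik]; last exact/w12/ltnW.
by congr (step _ _); apply: boolp.funext => v; apply: w12.
Qed.

Let Lam : R := rho0 + (2 * L.+1)%:R * W.

(** The coordinates that can influence the state at [x] after up to [L.+1] phases. *)
Definition seeds_near x : {set V} :=
  [set t | (st0 t == Some t) && `[< reach G [set: V] Lam x t >]].

Definition failure k x : {set Om} := [set w | state w k x == None].

(** * Failure probability of a single phase *)

Section OnePhase.
Variables (k : nat) (x : V).
Hypothesis kL : (k <= L)%N.
Local Notation k' := (inord k : 'I_L.+1).

Definition upd w t (b : B) : Om :=
  [ffun v => if v == t then [ffun i => if i == k' then b else w t i] else w v].

Lemma state_upd w t b : state (upd w t b) k = state w k.
Proof.
apply: state_ext => v i ik; rewrite ffunE; case: eqP => [->|//]; rewrite ffunE.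
case: eqP => // /(congr1 (@nat_of_ord _)); rewrite !inordK ?ltnS // => [ki|].
  by rewrite ki ltnn in ik.
by apply: leq_trans kL; apply: ltnW.
Qed.

Lemma upd_same w t b : upd w t b t k' = b.
Proof. by rewrite ffunE eqxx ffunE eqxx. Qed.

Lemma upd_other w t b v : v != t -> upd w t b v = w v.
Proof. by rewrite ffunE => /negPf->. Qed.

Lemma upd_upd w t b b' : upd (upd w t b) t b' = upd w t b'.
Proof.
apply/ffunP => v; rewrite !ffunE; case: eqP => // _.
by apply/ffunP => i; rewrite !ffunE eqxx !ffunE; case: eqP.
Qed.

Lemma upd_id w t : upd w t (w t k') = w.
Proof.
apply/ffunP => v; rewrite !ffunE; case: eqP => // ->.
by apply/ffunP => i; rewrite !ffunE; case: eqP => // ->.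
Qed.

Definition draw w : V -> B := fun v => w v k'.

(** The minimum runs over all vertices; those that are not seeds have [dist] equal to [cap] and
    cannot attain it. *)
Definition winner w : V := [arg min_(t < x) cost (state w k) (draw w) t x]%O.

Lemma winnerP w t : cost (state w k) (draw w) (winner w) x <=
                    cost (state w k) (draw w) t x.
Proof. by rewrite /winner; case: arg_minP => // i _; apply. Qed.

Lemma winner_near w : winner w \in seeds_near x.
Proof.
have inv := state_inv w k; have [_ r_ _ _] := inv; have W0 := W_ge0.
have D1 := D0.
have [s _ sD] := exists_dist_le h D0 inv x.
have tc : dist (state w k) (winner w) x < cap.
  apply: le_lt_trans (cost_ge G D0 _ (draw w) _ x) _.
  apply: le_lt_trans (winnerP w s) _.
  apply: le_lt_trans (cost_le G D0 _ (draw w) _ x) _.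
  rewrite /cap.
  apply: (@le_lt_trans _ _ (D + 2 * D * h%:R)); first by rewrite lerD2r.
  rewrite -subr_gt0.
  have -> : D * (2 * h%:R + 4) - (D + 2 * D * h%:R) = 3 * D by ring.
  lra.
have [v vt xv] := dist_reach D0 tc.
rewrite inE (state_seed vt) eqxx; apply/asboolP.
apply: reach_le (reach_trans (reachT xv) (reachT (r_ _ _ vt))).
have kW : k%:R * W <= L%:R * W by rewrite ler_wpM2r // ler_nat.
have LW : 0 <= L%:R * W by rewrite mulr_ge0.
have -> : Lam = rho0 + (W + W + L%:R * W + L%:R * W).
  by rewrite /Lam natrM -natr1; ring.
by have := W_cap; lra.
Qed.

Lemma half_subproof (b : B) : (b./2 < 2 ^ h)%N.
Proof.
by apply: leq_ltn_trans (ltn_ord b); rewrite -[leqRHS]odd_double_half; lia.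
Qed.

Definition half_ord (b : B) : B := Ordinal (half_subproof b).

(* Halving a nonzero draw lowers the value of its seed by exactly the margin
   required by [core], so that the seed which wins the phase now wins it
   decisively. *)
Definition boost w : Om := upd w (winner w) (half_ord (draw w (winner w))).

Lemma boost_core w : (0 < draw w (winner w))%N ->
  core (state w k) (draw (boost w)) (winner w) x.
Proof.
move=> b0; apply/(coreP D0 (state_inv w k)) => t' t't.
apply: le_trans (_ : cost (state w k) (draw w) t' x <= _); last first.
  by rewrite /cost /draw /boost upd_other.
apply: le_trans (winnerP w t').
rewrite /cost /draw /boost upd_same /= (bitlen_half b0) -[(bitlen _).+1%:R]natr1.
by rewrite mulrDr mulr1 addrA.
Qed.

Lemma boost_success w : w \in failure k x -> (0 < draw w (winner w))%N ->
  boost w \in failure k x :\: failure k.+1 x.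
Proof.
rewrite !inE /= => /eqP wk /boost_core wc.
rewrite /boost state_upd -/(boost w) wk eqxx andbT.
rewrite (step_touch D0 cluster_reach (state_inv w k) (t := winner w)) //.
by apply/existsP; exists x; rewrite eqxx.
Qed.

(** [boost] is at most two-to-one: the winner is recovered as the only seed with [x] in its core,
    and its draw from its half and its parity. *)
Lemma card_boost :
  (#|[set w in failure k x | (0 < draw w (winner w))%N]| <=
   2 * #|failure k x :\: failure k.+1 x|)%N.
Proof.
pose f w := (boost w, odd (draw w (winner w))).
have <- : #|setX (failure k x :\: failure k.+1 x) [set: bool]| =
    (2 * #|failure k x :\: failure k.+1 x|)%N.
  by rewrite cardsX cardsT card_bool mulnC.
rewrite -(card_in_imset (f := f)).
  apply: subset_leq_card.
  apply/subsetP => _ /imsetP[w + ->]; rewrite inE => /andP[wk w0].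
  by rewrite in_setX boost_success // inE.
move=> w1 w2; rewrite !inE => /andP[_ b1] /andP[_ b2] [bE oE].
have stE : state w1 k = state w2 k.
  by rewrite -(state_upd w1 (winner w1) (half_ord (draw w1 (winner w1))))
             -/(boost w1) bE state_upd.
have c1 := boost_core b1; have c2 := boost_core b2.
rewrite bE stE in c1; have wE := core_uniq D0 (state_inv w2 k) c1 c2.
have hE : half_ord (draw w1 (winner w1)) = half_ord (draw w2 (winner w2)).
  have := congr1 (fun w => w (winner w1) k') bE.
  by rewrite /boost upd_same wE upd_same.
have dE : draw w1 (winner w1) = draw w2 (winner w2).
  apply: val_inj; rewrite /= -[LHS]odd_double_half -[RHS]odd_double_half oE.
  by congr (_ + _.*2)%N; apply: (congr1 (@nat_of_ord _) hE).
rewrite -(upd_id w1 (winner w1)) -/(draw w1 (winner w1)) dE.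
rewrite -(upd_upd w1 _ (half_ord (draw w1 (winner w1)))) -/(boost w1) bE wE.
by rewrite upd_upd upd_id.
Qed.

(** Resampling the draw of [t] turns each outcome counted on the left into [2 ^ h] outcomes of
    [failure k x]; the original is recovered because its draw was zero. *)
Lemma card_zero_draw t :
  (2 ^ h * #|[set w in failure k x | draw w t == 0%N :> nat]| <=
   #|failure k x|)%N.
Proof.
set Z := [set w in _ | _].
have <- : #|setX Z [set: B]| = (2 ^ h * #|Z|)%N.
  by rewrite cardsX cardsT card_ord mulnC.
rewrite -(card_in_imset (f := fun wb => upd wb.1 t wb.2)).
  apply: subset_leq_card; apply/subsetP => _ /imsetP[[w b] + ->].
  by rewrite in_setX !inE state_upd => /andP[/andP[]].
move=> [w1 b1] [w2 b2]; rewrite !in_setX !inE /= !andbT.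
move=> /andP[_ /eqP z1] /andP[_ /eqP z2] E.
have bE : b1 = b2 by have := congr1 (fun w => w t k') E; rewrite !upd_same.
have dE : draw w1 t = draw w2 t by apply: val_inj; rewrite /= z1 z2.
rewrite bE; congr pair; rewrite -(upd_id w1 t) -(upd_id w2 t).
rewrite -/(draw w1 t) -/(draw w2 t) -dE.
by rewrite -(upd_upd w1 t b1) -(upd_upd w2 t b2) E.
Qed.

(** Given failure so far, a union bound over [seeds_near x] shows that the winner draws zero with
    probability at most N / 2^h <= 1/2. By [card_boost] the successes number at least half of the
    remaining outcomes, hence a quarter of all. *)
Lemma card_failureS (N : nat) : (#|seeds_near x| <= N)%N -> (2 * N <= 2 ^ h)%N ->
  (4 * #|failure k.+1 x| <= 3 * #|failure k x|)%N.
Proof.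
move=> SN Nh.
pose A := [set w in failure k x | (0 < draw w (winner w))%N].
have bad : (2 * #|failure k x :\: A| <= #|failure k x|)%N.
  pose Z t := [set w in failure k x | draw w t == 0%N :> nat].
  have : (2 ^ h * #|failure k x :\: A| <= N * #|failure k x|)%N.
    apply: (@leq_trans (2 ^ h * \sum_(t in seeds_near x) #|Z t|)%N).
      rewrite leq_mul2l; apply/orP; right; apply: leq_trans (card_bigcup_le _ Z).
      apply: subset_leq_card; apply/subsetP => w; rewrite !inE => /andP[+ wk].
      rewrite wk /= -eqn0Ngt => w0; apply/bigcupP.
      by exists (winner w); [exact: winner_near|rewrite !inE wk].
    apply: (@leq_trans (\sum_(t in seeds_near x) #|failure k x|)%N).
      by rewrite big_distrr /=; apply: leq_sum; move=> t _; apply: card_zero_draw.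
    by rewrite sum_nat_const leq_mul2r SN orbT.
  move: (expn_gt0 2 h) Nh; move: (2 ^ h)%N #|_ :\: A| #|failure k x| => p a f.
  by rewrite orTb; nia.
have fS : failure k.+1 x \subset failure k x.
  apply/subsetP => w; rewrite !inE /=; case wx: (state w k x) => [t|//].
  by rewrite (step_mono _ _ _ _ wx).
have := card_boost; have := cardsID A (failure k x).
have -> : failure k x :&: A = A.
  by apply/setIidPr/subsetP => w; rewrite inE => /andP[].
have := cardsID (failure k.+1 x) (failure k x); rewrite (setIidPr fS).
rewrite -/A; lia.
Qed.

End OnePhase.

Lemma card_failure N k x : (k <= L.+1)%N -> (#|seeds_near x| <= N)%N ->
  (2 * N <= 2 ^ h)%N -> (4 ^ k * #|failure k x| <= 3 ^ k * #|{: Om}|)%N.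
Proof.
move=> + SN Nh; elim: k => [|k IHk] kL.
  by rewrite !expn0 !mul1n max_card.
have := card_failureS kL SN Nh; have := IHk (ltnW kL); rewrite !expnS.
by move: (4 ^ k)%N (3 ^ k)%N => p q; nia.
Qed.

Hypothesis c_idem : forall x, c (c x) = c x.

Lemma aggregation (N Del : nat) :
  (forall x, #|seeds_near x| <= N)%N -> (2 * N <= 2 ^ h)%N ->
  (forall x, c x = x ->
     #|[set y | (c y == y) && `[< reach G [set: V] (Lam + Lam) x y >]]| <= Del)%N ->
  (0 < Del)%N -> (4 * Del * 3 ^ L.+1 <= 4 ^ L.+1)%N ->
  exists st, [/\ invariant (rho0 + L.+1%:R * W) st, forall x, st x <> None,
    forall x t, st x = Some t -> st0 t = Some t
    & forall x t, st0 x = Some t -> st x = Some t].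
Proof.
move=> SN Nh Hdel del0 Ldel.
(* Only representatives of clusters carry an event, so that the degree counts clusters and not
   vertices; elsewhere the event is empty. *)
pose E x := if c x == x then failure L.+1 x else set0.
pose S x := if c x == x then seeds_near x else set0.
suff [w wE] : exists w, forall x, w \notin E x.
  exists (state w L.+1); split=> [|x xN|x t /state_seed//|x t].
  - exact: state_inv.
  - have [st_c _ _ _] := state_inv w L.+1.
    by have := wE (c x); rewrite /E c_idem eqxx inE (st_c _ x) ?c_idem // xN.
  - exact: state_mono.
(* An event has probability at most (3/4)^(L+1) <= 1/(4 [Del]), and two events sharing a seed lie
   within [Lam + Lam]. *)
apply: (local_lemma (S := S) (K := (4 * Del)%N) (D := Del)) => //.
- move=> x w1 w2 w12; rewrite /E; case: eqP => [cx|_]; last by rewrite inE.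
  rewrite !inE (@state_local _ w1 w2) // => t tt xt; apply: w12.
  by rewrite /S cx eqxx inE tt eqxx; apply/asboolP.
- move=> x; rewrite /E; case: eqP => [cx|_]; last by rewrite cards0 muln0.
  have p0 : (0 < 3 ^ L.+1)%N by rewrite expn_gt0.
  rewrite -(leq_pmul2l p0); apply: leq_trans (card_failure (leqnn _) (SN x) Nh).
  by rewrite mulnA [(3 ^ _ * _)%N]mulnC leq_mul2r Ldel orbT.
- move=> x; have [cx|cx] := eqVneq (c x) x; last first.
    rewrite eq_card0 // => y; rewrite inE /S (negPf cx).
    by rewrite -setI_eq0 set0I eqxx.
  apply: leq_trans (Hdel x cx); apply: subset_leq_card.
  apply/subsetP => y; rewrite !inE /S cx eqxx.
  case: eqP => [cy|_]; last by rewrite -setI_eq0 setI0 eqxx.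
  rewrite -setI_eq0 => /set0Pn[t]; rewrite !inE.
  case/andP=> /andP[_ /asboolP xt] /andP[_ /asboolP yt].
  by apply/asboolP; apply: reach_trans xt (reach_sym yt).
- by lia.
- by apply/card_gt0P; exists [ffun=> [ffun=> Ordinal (expn_gt0 2 h)]].
Qed.

End Aggregation.

(** * From one scale to the next *)

Lemma maximal_independent (V : finType) (e : rel V) (Q : {set V}) :
  reflexive e -> symmetric e ->
  exists M : {set V}, [/\ M \subset Q,
    {in M &, forall x y, e x y -> x = y}
    & forall x, x \in Q -> exists2 y, y \in M & e x y].
Proof.
move=> e_refl e_sym.
pose P (A : {set V}) :=
  (A \subset Q) && [forall x in A, forall y in A, e x y ==> (x == y)].
have [|M /maxsetP[/andP[MQ /'forall_in_forall_inP MI] Mmax]] := @ex_maxset _ P.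
  by exists set0; rewrite /P sub0set; apply/forall_inP => x; rewrite inE.
have MI' : {in M &, forall x y, e x y -> x = y}.
  by move=> x y xM yM exy; apply/eqP; have /implyP := MI x xM y yM; apply.
exists M; split=> // x xQ.
case: (boolP [exists y in M, e x y]) => [/exists_inP//|/exists_inPn xM].
exists x => //; rewrite -(Mmax (x |: M)) ?setU11 ?subsetUr //.
apply/andP; split; first by rewrite subUset sub1set xQ.
apply/'forall_in_forall_inP => y yxM z zxM; apply/implyP => yz; apply/eqP.
move: yxM zxM; rewrite !inE => /predU1P[yx|yM] /predU1P[zx|zM].
- by rewrite yx zx.
- by move: yz; rewrite yx (negPf (xM z zM)).
- by move: yz; rewrite zx e_sym (negPf (xM y yM)).
- exact: MI'.
Qed.

Lemma greedy_coloring (V : finType) (e : rel V) (N : {set V}) (k : nat) :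
  reflexive e -> symmetric e -> (0 < k)%N ->
  (forall x, x \in N -> #|[set y in N | e x y]| <= k)%N ->
  exists col : V -> 'I_k,
    {in N &, forall x y, e x y -> col x = col y -> x = y}.
Proof.
move=> e_refl e_sym k0 Nk.
suff H n (A : {set V}) : #|A| = n -> A \subset N -> exists col : V -> 'I_k,
    {in A &, forall x y, e x y -> col x = col y -> x = y} by exact: (H #|N| N).
elim: n A => [|n IHn] A An AN.
  exists (fun=> Ordinal k0) => x y; suff -> : A = set0 by rewrite inE.
  by apply/eqP; rewrite -cards_eq0 An.
have [a aA] : exists a, a \in A by apply/card_gt0P; rewrite An.
have [||col colP] := IHn (A :\ a).
- by have := cardsD1 a A; rewrite aA An => -[].
- exact: subset_trans (subsetDl _ _) AN.
pose used := [set col y | y in A :\ a & e a y].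
have [j jU] : exists j, j \notin used.
  apply/existsP; rewrite -negb_forall; apply/negP => /forallP all_used.
  have : (k <= #|used|)%N.
    rewrite -[leqLHS]card_ord -cardsT; apply: subset_leq_card.
    by apply/subsetP => j _; apply: all_used.
  (* [Nk] counts [a] among its own neighbours, so fewer than [k] colours are in use around it. *)
  apply/negP; rewrite -ltnNge; apply: leq_trans (Nk a (subsetP AN a aA)).
  apply: leq_ltn_trans (leq_imset_card _ _) _; apply: proper_card.
  apply/properP; split.
    apply/subsetP => y; rewrite !inE => /andP[/andP[_ yA] ->].
    by rewrite (subsetP AN).
  by exists a; rewrite !inE ?eqxx // (subsetP AN) // e_refl.
exists (fun x => if x == a then j else col x) => x y xA yA exy.
have jcol z : z \in A -> z != a -> e a z -> j <> col z.
  move=> zA za ez jz; move/negP: jU; apply; rewrite jz.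
  by apply: imset_f; rewrite !inE za zA.
case: eqVneq => [xa|xa]; case: eqVneq => [ya|ya].
- by rewrite xa ya.
- by move/jcol; case=> //; rewrite -xa.
- by move/esym/jcol; case=> //; rewrite -ya e_sym.
- by apply: colP; rewrite ?inE ?xa ?ya.
Qed.

Section Levels.
Context {R : realType} {V : finType} (G : wgraph R V).
Variables (K m h L : nat).
Hypothesis doubling : doubling_bound G K.
Hypothesis K0 : (0 < K)%N.
Local Notation mu := (2 ^+ m : R).
(** Packing number for radius [2 * mu ^+ i.+1] and separation [mu ^+ i / mu]: [2 * m + 3] halvings
    bring the radius to a quarter of the separation. *)
Local Notation Del := (K ^ (2 * m + 3))%N.
Hypothesis Del_h : (2 * Del <= 2 ^ h)%N.
Hypothesis Del_L : (4 * Del * 3 ^ L.+1 <= 4 ^ L.+1)%N.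
Hypothesis m_large : (4 * (2 + L.+1 * (2 * h + 5)) <= 2 ^ m)%N.
Implicit Types (c : V -> V) (i : nat).

(** A scale is encoded by the map from each vertex to the centre of its cluster. The separation
    mu^(i-1) of the centres is written [mu ^+ i / mu] to make sense at scale 0. *)
Definition level i c : Prop :=
  [/\ forall x, c (c x) = c x,
      forall x, reach G (cluster c x) (mu ^+ i / 2) x (c x)
    & forall x y, c x = x -> c y = y ->
        reach G [set: V] (mu ^+ i / mu) x y -> x = y].

Lemma level_cluster i c : level i c ->
  forall x y, c x = c y -> reach G (cluster c x) (mu ^+ i) x y.
Proof.
case=> _ c_r _ x y cxy.
have cE : cluster c x = cluster c y by apply/setP => z; rewrite !inE cxy.
rewrite (splitr (mu ^+ i)); apply: reach_trans (c_r x) _.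
by rewrite cxy cE; apply/reach_sym/c_r.
Qed.

Lemma mu_gt0 i : 0 < mu ^+ i. Proof. by rewrite !exprn_gt0. Qed.

Lemma count_separated i (X : {set V}) v :
  (forall x, x \in X -> reach G [set: V] (2 * mu ^+ i.+1) v x) ->
  {in X &, forall x y, reach G [set: V] (mu ^+ i / mu) x y -> x = y} ->
  (#|X| <= Del)%N.
Proof.
have i0 := mu_gt0 i; have m0 : 0 < mu by rewrite exprn_gt0.
move=> Xv Xs; apply: (packing doubling _ _ Xv Xs).
  by rewrite mulr_gt0 // mu_gt0.
have -> : 2 ^+ (2 * m + 3) = mu ^+ 2 * 2 ^+ 3 :> R.
  by rewrite exprD mulnC exprM.
rewrite [mu ^+ i.+1]exprS; move: mu m0 i0 => p p0.
move: (p ^+ i) => q q0; rewrite -subr_gt0.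
have -> : q / p - 2 * (2 * (p * q) / (p ^+ 2 * 2 ^+ 3)) = q / p / 2.
  by field; rewrite lt0r_neq0.
by rewrite !divr_gt0.
Qed.

Lemma mu_large : 4 * (2 + L.+1%:R * (2 * h%:R + 5)) <= mu.
Proof.
move: m_large; rewrite -(ler_nat R) natrX; apply: le_trans.
by rewrite !(natrM, natrD).
Qed.

Section NextLevel.
Variables (i : nat) (c : V -> V) (T : {set V}).
Hypothesis lev : level i c.
Local Notation D := (mu ^+ i).
Local Notation M := (mu ^+ i.+1).
Hypothesis T_sep :
  {in T &, forall s t, reach G [set: V] (M / 2) s t -> s = t}.

Lemma M_large : 4 * (2 * D + L.+1%:R * (D * (2 * h%:R + 5))) <= M.
Proof.
have := mu_large; rewrite -(ler_pM2r (mu_gt0 i)) -exprS; apply: le_trans.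
by rewrite le_eqVlt; apply/orP; left; apply/eqP; ring.
Qed.

Lemma M_ge8 : 8 * D <= M.
Proof.
apply: le_trans M_large.
have : 0 <= L.+1%:R * (D * (2 * h%:R + 5)).
  by rewrite !mulr_ge0 ?ltW ?mu_gt0 // ltr_wpDl // mulr_ge0.
lra.
Qed.

Definition touched t x : bool :=
  [exists y, (c y == c x) && `[< reach G [set: V] (M / 8) t y >]].

Lemma touched_c t x y : c x = c y -> touched t x = touched t y.
Proof. by rewrite /touched => ->. Qed.

(** Two such balls joined by a cluster span at most [M / 4 + D], below the separation [M / 2] since
    [8 * D <= M]. *)
Lemma touched_uniq s t x : s \in T -> t \in T ->
  touched s x -> touched t x -> s = t.
Proof.
move=> sT tT /existsP[y /andP[/eqP cy /asboolP sy]].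
case/existsP=> z /andP[/eqP cz /asboolP tz]; apply: T_sep => //.
have yz := reachT (level_cluster lev (etrans cy (esym cz))).
apply: reach_le (reach_trans sy (reach_trans yz (reach_sym tz))).
have := mu_gt0 i; have := M_ge8; lra.
Qed.

Definition far : {set V} := [set x | ~~ [exists t in T, touched t x]].

Variable N : {set V}.
Hypothesis N_far : N \subset far.
Hypothesis N_sep : {in N &, forall s t, reach G [set: V] D s t -> s = t}.
Hypothesis N_max :
  forall x, x \in far -> exists2 y, y \in N & reach G [set: V] D x y.

Definition start x : option V :=
  if [pick t in T | touched t x] is Some t then Some t
  else [pick t in N | c x == c t].

Lemma start_T t x : t \in T -> touched t x -> start x = Some t.
Proof.
move=> tT tx; rewrite /start; case: pickP => [s /andP[sT sx]|/(_ t)].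
  by rewrite (touched_uniq sT tT sx tx).
by rewrite tT tx.
Qed.

(** A point of [N] is far, so no ball around [T] claims its cluster; and no cluster holds two points
    of [N], as its diameter is at most [D]. *)
Lemma start_N t x : t \in N -> c x = c t -> start x = Some t.
Proof.
move=> tN cx; rewrite /start; case: pickP => [s /andP[sT sx]|_].
  have := subsetP N_far t tN; rewrite inE => /exists_inP[].
  by exists s; rewrite // -(touched_c s cx).
case: pickP => [s /andP[sN /eqP cs]|/(_ t)]; last by rewrite tN cx eqxx.
congr Some; apply: N_sep => //.
by apply/reachT/(level_cluster lev); rewrite -cs.
Qed.

Lemma startP x t : start x = Some t ->
  (t \in T /\ touched t x) \/ (t \in N /\ c x = c t).
Proof.
rewrite /start; case: pickP => [s /andP[sT sx] [<-]|_]; first by left.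
by case: pickP => // s /andP[sN /eqP cs] [<-]; right.
Qed.

Lemma start_c x y : c x = c y -> start x = start y.
Proof.
move=> cxy; rewrite /start (eq_pick (Q := [pred t in T | touched t y])).
  by case: pickP => // _; apply: eq_pick => t; rewrite /= cxy.
by move=> t; rewrite /= (touched_c t cxy).
Qed.

Lemma touched_reach t x : reach G [set: V] (M / 8) t x -> touched t x.
Proof. by move=> tx; apply/existsP; exists x; rewrite eqxx; apply/asboolP. Qed.

Lemma start_invariant : invariant G c D (M / 8 + D) start.
Proof.
have i0 := mu_gt0 i; have i1 := mu_gt0 i.+1.
have M80 : 0 <= M / 8 by rewrite divr_ge0 ?ltW.
split.
- exact: start_c.
- move=> x t xt.
  have sub y : start y = Some t -> cluster c y \subset part start t.
    by move=> yt; apply/subsetP => z; rewrite !inE => /eqP /start_c ->; apply/eqP.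
  case: (startP xt) => [[tT /existsP[y /andP[/eqP cy /asboolP ty]]]|[tN cx]].
    rewrite addrC; apply: (@reach_trans _ _ _ _ _ _ _ y).
      by apply: reach_sub (sub x xt) _; apply: level_cluster.
    (* Every vertex of the path from [t] is itself within [M / 8] of [t], so the whole path lies in
       the part of [t]. *)
    apply/reach_sym; apply: reach_local ty => z tz _; rewrite inE.
    by rewrite (start_T tT) //; apply: touched_reach.
  apply: (@reach_le _ _ _ _ D); first by rewrite lerDr.
  by apply: reach_sub (sub x xt) _; apply: level_cluster.
- move=> x t /startP[[tT _]|[tN _]]; last exact: start_N.
  by apply: start_T => //; apply/touched_reach/reach_refl.
- move=> x; case: (boolP (x \in far)) => [/N_max[t tN xt]|].
    by exists t => //; rewrite (start_N tN).
  rewrite inE negbK => /exists_inP[t tT tx]; exists x; first by rewrite (start_T tT).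
  exact/reach_refl/ltW.
Qed.

Lemma start_sep s t : start s = Some s -> start t = Some t ->
  reach G [set: V] D s t -> s = t.
Proof.
have i0 := mu_gt0 i; have M8 := M_ge8.
have TN x y : x \in T -> y \in N -> reach G [set: V] D x y -> x = y.
  move=> xT yN xy; have := subsetP N_far y yN; rewrite inE => /exists_inP[].
  by exists x => //; apply: touched_reach; apply: reach_le xy; lra.
move=> /startP[[sT _]|[sN _]] /startP[[tT _]|[tN _]] st.
- by apply: T_sep => //; apply: reach_le st; lra.
- exact: TN.
- by apply/esym/TN => //; apply: reach_sym.
- exact: N_sep.
Qed.

Lemma next_level_aux : exists c', [/\ level i.+1 c',
  forall x y, c x = c y -> c' x = c' y
  & forall t y, t \in T -> reach G [set: V] (M / 8) t y -> c' y = t].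
Proof.
have i0 := mu_gt0 i; have i1 := mu_gt0 i.+1; have ML := M_large.
have m0 : 0 < mu by rewrite exprn_gt0.
have m1 : 1 <= mu by rewrite exprn_ege1 // ler1n.
have DM : D / mu <= D by rewrite ler_pdivrMr // ler_peMr // ltW.
have [c_idem c_r c_sep] := lev.
set W := D * (2 * h%:R + 5) in ML *.
(* This bounds [Lam] by [M], so the seeds near [x] and the conflicting clusters both lie within
   [2 * M] of [x], as [count_separated] requires. *)
have LamE : M / 8 + D + (2 * L.+1)%:R * W <= M.
  by rewrite natrM; lra.
have [|||||st [inv st_all st_seed st_start]] :=
  aggregation (L := L) (h := h) i0 (level_cluster lev) start_invariant c_idem
    (N := Del) (Del := Del).
- move=> x; apply: (@count_separated i _ x) => [t|s t].
    by rewrite inE => /andP[_ /asboolP]; apply: reach_le; rewrite -/W; lra.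
  rewrite !inE => /andP[/eqP ss _] /andP[/eqP tt _] /(reach_le DM).
  exact: start_sep.
- exact: Del_h.
- move=> x cx; apply: (@count_separated i _ x) => [t|s t].
    by rewrite inE => /andP[_ /asboolP]; apply: reach_le; rewrite -/W; lra.
  rewrite !inE => /andP[/eqP ss _] /andP[/eqP tt _].
  exact: c_sep.
- by rewrite expn_gt0 K0.
- exact: Del_L.
have [st_c st_r st_t _] := inv.
pose c' x := odflt x (st x).
have c'P x : st x = Some (c' x) by rewrite /c'; case: (st x) (st_all x).
exists c'; split; first split.
- by move=> x; rewrite {1}/c' (st_t _ _ (c'P x)).
- move=> x; have -> : cluster c' x = part st (c' x).
    by apply/setP => z; rewrite !inE c'P.
  by apply: reach_le (st_r _ _ (c'P x)); rewrite -/W; lra.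
(* The separation needed at scale [i.+1] is [M / mu = D], and the new centres are seeds. *)
- move=> x y cx cy; rewrite exprS mulrC mulKf ?lt0r_neq0 //.
  apply: start_sep.
    exact: st_seed (etrans (c'P x) (congr1 Some cx)).
  exact: st_seed (etrans (c'P y) (congr1 Some cy)).
- by move=> x y /st_c cxy; apply: Some_inj; rewrite -!c'P.
- move=> t y tT ty; apply: Some_inj; rewrite -c'P.
  by apply: st_start; apply: start_T => //; apply: touched_reach.
Qed.

End NextLevel.

Lemma reachb_refl r : 0 <= r ->
  reflexive (fun x y => `[< reach G [set: V] r x y >]).
Proof. by move=> r0 x; apply/asboolP/reach_refl. Qed.

Lemma reachb_sym r : symmetric (fun x y => `[< reach G [set: V] r x y >]).
Proof. by move=> x y; apply/asboolP/asboolP; apply: reach_sym. Qed.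

Lemma next_level i c (T : {set V}) : level i c ->
  {in T &, forall s t, reach G [set: V] (mu ^+ i.+1 / 2) s t -> s = t} ->
  exists c', [/\ level i.+1 c',
    forall x y, c x = c y -> c' x = c' y
    & forall t y, t \in T -> reach G [set: V] (mu ^+ i.+1 / 8) t y -> c' y = t].
Proof.
move=> lev T_sep.
have [N [N_far N_sep N_max]] := maximal_independent (far i c T)
  (reachb_refl (ltW (mu_gt0 i))) (@reachb_sym (mu ^+ i)).
apply: (next_level_aux lev T_sep N_far) => [s t sN tN st|x /N_max[y yN /asboolP xy]].
  by apply: N_sep => //; apply/asboolP.
by exists y.
Qed.

End Levels.

(** * The hierarchical partition family *)

Section Family.
Context {R : realType} {V : finType} (G : wgraph R V).

Definition map_partitions (f : nat -> V -> V) (I : nat) : seq {set {set V}} :=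
  mkseq (fun i => preim_partition (f i) [set: V]) I.+1.

Lemma scale_map_partitions (f : nat -> V -> V) I i : (i <= I)%N ->
  scale_partition (map_partitions f I) i = preim_partition (f i) [set: V].
Proof. by move=> iI; rewrite /scale_partition nth_mkseq. Qed.

Lemma preim_partitionE (c : V -> V) :
  preim_partition c [set: V] = [set cluster c x | x : V].
Proof.
apply/setP => C; apply/imsetP/imsetP => -[x _ ->]; exists x; rewrite ?inE //;
  by apply/setP => y; rewrite !inE eq_sym.
Qed.

Lemma cluster_mem (c : V -> V) x : x \in cluster c x.
Proof. by rewrite inE. Qed.

Lemma cluster_eq (c : V -> V) x y : y \in cluster c x -> cluster c y = cluster c x.
Proof. by rewrite inE => /eqP cy; apply/setP => z; rewrite !inE cy. Qed.

Lemma map_partitions_HP (f : nat -> V -> V) (I : nat) (mu : R) (x0 : V) :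
  0 <= mu -> (forall x, f 0 x = x) -> (forall x y, f I x = f I y) ->
  (forall i, (i < I)%N -> forall x y, f i x = f i y -> f i.+1 x = f i.+1 y) ->
  (forall i, (i <= I)%N -> forall x y, f i x = f i y ->
     reach G (cluster (f i) x) (mu ^+ i) x y) ->
  is_HP G mu (map_partitions f I).
Proof.
move=> mu0 f0 fI fS f_reach; rewrite /is_HP size_mkseq.
split.
- by split=> // i iI; rewrite scale_map_partitions //; apply: preim_partitionP.
- move=> C; rewrite scale_map_partitions // preim_partitionE => /imsetP[x _ ->].
  have -> : cluster (f 0) x = [set x] by apply/setP => y; rewrite !inE !f0.
  exact: cards1.
- rewrite scale_map_partitions //= preim_partitionE.
  apply/setP => C; rewrite inE; apply/imsetP/eqP => [[x _ ->]|->].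
    by apply/setP => y; rewrite !inE (fI y x) eqxx.
  by exists x0 => //; apply/setP => y; rewrite !inE (fI y x0) eqxx.
- move=> i C iI; rewrite scale_map_partitions // preim_partitionE => /imsetP[x _ ->].
  apply: bigmax_le => [|[u v] /=]; first by rewrite lee_fin exprn_ge0.
  rewrite in_setX => /andP[ux vx]; apply: graph_dist_le.
  rewrite -(cluster_eq ux); apply: f_reach => //.
  by move: ux vx; rewrite !inE => /eqP -> /eqP.
- move=> i C iI; rewrite scale_map_partitions // preim_partitionE => /imsetP[x _ ->].
  exists [set cluster (f i) y | y in cluster (f i.+1) x].
  have iI' : (i <= I)%N by apply: ltnW.
  rewrite scale_map_partitions // preim_partitionE; split.
    by apply/subsetP => _ /imsetP[y _ ->]; apply: imset_f.
  apply/setP => y; apply/idP/bigcupP => [yx|[_ /imsetP[z zx ->]]].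
    by exists (cluster (f i) y); [apply: imset_f|rewrite cluster_mem].
  by move: zx; rewrite !inE => /eqP <- /eqP /fS ->.
Qed.

Variables (K m h L : nat).
Hypothesis doubling : doubling_bound G K.
Hypothesis K0 : (0 < K)%N.
Local Notation mu := (2 ^+ m : R).
Local Notation Del := (K ^ (2 * m + 3))%N.
Hypothesis Del_h : (2 * Del <= 2 ^ h)%N.
Hypothesis Del_L : (4 * Del * 3 ^ L.+1 <= 4 ^ L.+1)%N.
Hypothesis m_large : (4 * (2 + L.+1 * (2 * h + 5)) <= 2 ^ m)%N.
Hypothesis normalized : normalized_graph G.
Hypothesis connected : connected_graph G.
Implicit Types (c : V -> V) (i : nat).

Lemma mu_ge8 : 8 <= mu.
Proof.
have := mu_large (R := R) m_large.
have : 0 <= L.+1%:R * (2 * h%:R + 5) :> R.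
  by rewrite mulr_ge0 // addr_ge0 ?mulr_ge0.
lra.
Qed.

Lemma reach_lt1 r x y : r < 1 -> reach G [set: V] r x y -> x = y.
Proof.
move=> r1 /graph_dist_leT xy; apply/eqP; apply: contraT => /normalized.
by move/le_trans => /(_ _ xy); rewrite lee_fin leNgt r1.
Qed.

Lemma levels_exist (T : nat -> {set V}) :
  (forall i, {in T i &, forall s t,
     reach G [set: V] (mu ^+ i.+1 / 2) s t -> s = t}) ->
  exists c : nat -> V -> V, [/\ forall x, c 0 x = x,
    forall i, level G m i (c i),
    forall i x y, c i x = c i y -> c i.+1 x = c i.+1 y
    & forall i t y, t \in T i -> reach G [set: V] (mu ^+ i.+1 / 8) t y ->
        c i.+1 y = t].
Proof.
move=> T_sep.
have /boolp.choice[F FP] : forall ic : nat * (V -> V), exists c',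
    level G m ic.1 ic.2 ->
    [/\ level G m ic.1.+1 c', forall x y, ic.2 x = ic.2 y -> c' x = c' y
      & forall t y, t \in T ic.1 ->
          reach G [set: V] (mu ^+ ic.1.+1 / 8) t y -> c' y = t].
  move=> [i c] /=; have [lev|nlev] := boolp.pselect (level G m i c).
    have [c' c'P] := next_level doubling K0 Del_h Del_L m_large lev (T_sep i).
    by exists c'.
  by exists c.
pose c := fix c i := if i is i'.+1 then F (i', c i') else (fun x : V => x).
have c_lev i : level G m i (c i).
  elim: i => [|i IHi] /=; last by have [] := FP (i, c i) IHi.
  split=> // [x|x y _ _].
    by apply: reach_refl; rewrite divr_ge0.
  (* At scale 0 all vertices are centres; the separation 1/mu asked for is below the minimal
     distance 1. *)
  apply: reach_lt1; rewrite expr0 div1r invf_lt1; have := mu_ge8; lra.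
exists c; split=> // i; first by have [_ + _] := FP (i, c i) (c_lev i).
by have [_ _] := FP (i, c i) (c_lev i).
Qed.

Lemma family_exists : exists F : seq (seq {set {set V}}),
  [/\ is_HPF G 32 mu F, (size F = K ^ 5)%N
    & forall P (i : nat) (C : {set V}),
        P \in F -> (i.+1 < size P)%N -> C \in scale_partition P i.+1 ->
        (cluster_degree P i C <= Del)%N].
Proof.
have mu8 := mu_ge8; have mu0 : 0 < mu by lra.
have mui i : 0 < mu ^+ i by rewrite exprn_gt0.
have x0 : V by case: connected => /card_gt0P/sigW[].
have K5 : (0 < K ^ 5)%N by rewrite expn_gt0 K0.
(* From scale [I] on a single cluster is used; [0 < I] keeps scale 0 for the singletons. *)
have [I I0 diam] : exists2 I, (0 < I)%N & forall x y, reach G [set: V] (mu ^+ I) x y.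
  have [r r0 rP] := connected_reach connected.
  have [k rk] : exists k : nat, r < k%:R.
    by exists (Num.truncn r).+1; apply: truncnS_gt.
  exists k.+1 => // x y; apply: reach_le (rP x y); apply: le_trans (ltW rk) _.
  rewrite -exprM -natrX ler_nat; apply: leq_trans (ltnW (ltn_expl k (ltnSn 1))) _.
  rewrite leq_exp2l // mulnC; apply: leq_trans (leqnSn k) _.
  rewrite leq_pmulr // lt0n; apply/eqP => m0.
  by move: mu8; rewrite m0 expr0; lra.
have /boolp.choice[N NP] : forall i, exists N : {set V},
    {in N &, forall s t, reach G [set: V] (mu ^+ i.+1 / 16) s t -> s = t} /\
    forall x, exists2 t, t \in N & reach G [set: V] (mu ^+ i.+1 / 16) x t.
  move=> i; have [|N [_ N_sep N_max]] := maximal_independent [set: V]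
      (@reachb_refl _ _ G (mu ^+ i.+1 / 16) _) (reachb_sym G (mu ^+ i.+1 / 16)).
    by rewrite divr_ge0 // ltW.
  exists N; split=> [s t sN tN st|x]; first by apply: N_sep => //; apply/asboolP.
  by have [//|t tN /asboolP xt] := N_max x; exists t.
(* Five halvings of the radius [mu ^+ i.+1 / 2] give 1/64 of [mu ^+ i.+1], less than half the net
   separation 1/16; so [K ^ 5] colours suffice. *)
have /boolp.choice[col colP] : forall i, exists col : V -> 'I_(K ^ 5),
    {in N i &, forall s t, reach G [set: V] (mu ^+ i.+1 / 2) s t ->
       col s = col t -> s = t}.
  move=> i; have [N_sep _] := NP i.
  have [||col colP] := greedy_coloring (N := N i) (e := fun x y => _) 
    (@reachb_refl _ _ G (mu ^+ i.+1 / 2) _) (reachb_sym G (mu ^+ i.+1 / 2)) K5.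
  - by rewrite divr_ge0 // ltW.
  - move=> x xN; apply: (packing (r := mu ^+ i.+1 / 2) (v := x)
      (sep := mu ^+ i.+1 / 16) doubling).
    + by rewrite divr_gt0.
    + by rewrite -subr_gt0; have := mui i.+1; lra.
    + by move=> y; rewrite inE => /andP[_ /asboolP].
    + by move=> y z; rewrite !inE => /andP[yN _] /andP[zN _]; apply: N_sep.
  by exists col => s t sN tN /asboolP st; apply: colP.
have /boolp.choice[c cP] : forall j : 'I_(K ^ 5), exists c : nat -> V -> V,
    [/\ forall x, c 0 x = x, forall i, level G m i (c i),
      forall i x y, c i x = c i y -> c i.+1 x = c i.+1 y
    & forall i t y, t \in N i -> col i t = j ->
        reach G [set: V] (mu ^+ i.+1 / 8) t y -> c i.+1 y = t].
  move=> j; have [|c [c0 c_lev cS cT]] :=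
      @levels_exist (fun i => [set t in N i | col i t == j]).
    move=> i s t; rewrite !inE => /andP[sN /eqP sj] /andP[tN /eqP tj] st.
    by apply: colP st _ => //; rewrite sj tj.
  by exists c; split=> // i t y tN tj; apply: cT; rewrite inE tN tj eqxx.
pose f j i := if (i < I)%N then c j i else (fun=> x0).
pose P j := map_partitions (f j) I.
have fI j i : (i < I)%N -> f j i = c j i by rewrite /f => ->.
have P_HP j : is_HP G mu (P j).
  have [c0 c_lev cS cT] := cP j.
  apply: (map_partitions_HP x0); first exact: ltW.
  - by move=> x; rewrite /f I0.
  - by move=> x y; rewrite /f ltnn.
  - move=> i iI x y; rewrite fI // /f; case: ifP => // _; exact: cS.
  - move=> i iI x y; rewrite /f; case: ltnP => [_|Ii].
      exact: level_cluster.
    move=> _; have -> : cluster (fun=> x0) x = [set: V].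
      by apply/setP => z; rewrite !inE eqxx.
    by have -> : i = I by apply/eqP; rewrite eqn_leq iI Ii.
exists [seq P j | j <- enum 'I_(K ^ 5)]; split.
- split=> [_ /mapP[j _ ->] //|v [|i]].
    (* At scale 0 the ball of radius 1/32 is a single vertex, so any member of the family serves. *)
    exists (P (Ordinal K5)), [set v]; split.
    + by apply: map_f; rewrite mem_enum.
    + have [c0 _ _ _] := cP (Ordinal K5).
      rewrite scale_map_partitions // preim_partitionE; apply/imsetP; exists v => //.
      by apply/setP => x; rewrite !inE fI // !c0.
    + apply/subsetP => u; rewrite !inE expr0 => /graph_dist_lt vu.
      apply/eqP/esym/(@reach_lt1 (1 / 16)); first lra.
      by apply: vu; lra.
  (* In units of [mu ^+ i.+1], the ball of radius 1/32 around [v] lies within 1/16 + 1/16 of a net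
     point [t], and the hierarchy for the colour of [t] keeps the ball of radius 1/8 around [t] in
     one cluster. *)
  have [t tN vt] := (NP i).2 v.
  have [c0 c_lev cS cT] := cP (col i t).
  exists (P (col i t)).
  have [iI|Ii] := ltnP i.+1 I; last first.
    exists [set: V]; split; last exact: subsetT.
      by apply: map_f; rewrite mem_enum.
    case: ltngtP Ii => // [Ii _|Ii _].
      by rewrite /scale_partition nth_default ?inE // size_mkseq.
    rewrite -Ii scale_map_partitions // preim_partitionE; apply/imsetP.
    by exists x0 => //; apply/setP => x; rewrite !inE /f ltnn eqxx.
  exists (cluster (c (col i t) i.+1) t); split.
  + by apply: map_f; rewrite mem_enum.
  + by rewrite scale_map_partitions 1?ltnW // preim_partitionE fI // imset_f.
  + apply/subsetP => u; rewrite !inE => /graph_dist_lt vu.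
    have tt : c (col i t) i.+1 t = t.
      by apply: cT => //; apply: reach_refl; rewrite divr_ge0 // ltW.
    rewrite tt; apply/eqP/cT => //.
    have -> : mu ^+ i.+1 / 8 = mu ^+ i.+1 / 16 + mu ^+ i.+1 / 16 by lra.
    apply: reach_trans (reach_sym vt) (vu _ _).
    by have := mui i.+1; lra.
- by rewrite size_map -cardE card_ord.
- move=> _ i C /mapP[j _ ->]; rewrite size_mkseq ltnS => iI.
  have [c0 c_lev cS cT] := cP j; have [c_idem c_r c_sep] := c_lev i.
  have HP := P_HP j.
  rewrite scale_map_partitions // preim_partitionE => /imsetP[v _ CE].
  have vC u : u \in C -> reach G [set: V] (mu ^+ i.+1) v u.
    rewrite CE inE /f; case: ltnP => [iI'|Ii] /eqP uv.
      exact: reachT (level_cluster (c_lev i.+1) (esym uv)).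
    by have -> : i.+1 = I by apply/eqP; rewrite eqn_leq iI Ii.
  (* A child is counted by its centre, which lies in the child and so in [C]. *)
  pose X := [set y in C | c j i y == y].
  apply: (@leq_trans #|X|); last first.
    apply: (count_separated doubling (i := i) (v := v)).
      move=> x; rewrite inE => /andP[/vC + _]; apply: reach_le.
      by have := mui i.+1; lra.
    move=> x y; rewrite !inE => /andP[_ /eqP cx] /andP[_ /eqP cy].
    exact: c_sep.
  apply: leq_trans (leq_imset_card (cluster (c j i)) X).
  apply: subset_leq_card; apply/subsetP => E; rewrite inE.
  rewrite scale_map_partitions ?(ltnW iI) // preim_partitionE fI //.
  case/andP=> /imsetP[x _ ->] /subsetP xC; apply/imsetP; exists (c j i x).
    by rewrite inE c_idem eqxx andbT; apply: xC; rewrite inE c_idem.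
  by apply/esym/cluster_eq; rewrite inE c_idem.
Qed.

End Family.

(** * Choice of the parameters *)

Section SmallDimension.
Context {R : realType} {V : finType} (G : wgraph R V).
Hypothesis normalized : normalized_graph G.
Hypothesis connected : connected_graph G.

(** When one ball suffices at each halving, packing bounds the number of points by 1^k = 1 at any
    separation. *)
Lemma doubling1_card : doubling_bound G 1 -> (#|V| <= 1)%N.
Proof.
move=> doubling; have [r r0 rP] := connected_reach connected.
have [x0 _] : exists x0, x0 \in V by apply/card_gt0P; case: connected.
pose k := (Num.truncn (4 * (r + 1))).+1.
have kP : 4 * (r + 1) < 2 ^+ k.
  apply: lt_trans (truncnS_gt _) _.
  by rewrite -natrX ltr_nat ltn_expl.
rewrite -(exp1n k) -cardsT.
apply: (packing (r := r + 1) (v := x0) (sep := 1 / 2) doubling).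
- by lra.
- rewrite mulrA ltr_pdivrMr ?exprn_gt0 //; lra.
- by move=> x _; apply: reach_le (rP x0 x); lra.
- by move=> x y _ _; apply: reach_lt1 => //; lra.
Qed.

Lemma trivial_family (rho mu : R) : 0 <= mu -> (#|V| <= 1)%N ->
  exists F : seq (seq {set {set V}}),
    [/\ is_HPF G rho mu F, size F = 1%N & forall P, P \in F -> size P = 1%N].
Proof.
move=> mu0 V1; pose P := map_partitions (fun _ (x : V) => x) 0.
have VE (x y : V) : x = y by have /fintype_le1P/(_ y x) := V1.
have [x0 _] : exists x0, x0 \in V by apply/card_gt0P; case: connected.
have P_HP : is_HP G mu P.
  apply: (map_partitions_HP x0) => // i _ x y ->.
  by apply: reach_refl; rewrite exprn_ge0.
exists [:: P]; split=> //; last by move=> Q; rewrite inE => /eqP ->.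
split=> [Q|v i]; first by rewrite inE => /eqP ->.
exists P, [set: V]; split; rewrite ?inE ?subsetT //.
have [_ _ PE _ _] := P_HP.
have P0 : scale_partition P 0 = [set [set: V]] := PE.
case: i => [|i]; first by rewrite P0 inE.
by rewrite /scale_partition nth_default ?inE.
Qed.

End SmallDimension.

(** * Numerical estimates and conclusion *)

Definition dim_ceil {R : realType} (d : R) : nat := (Num.truncn d).+1.
(** The growth factor is 2^24 n^3 with [n] rounded up to a power of two. *)
Definition growth_exp (n : nat) : nat := (3 * up_log 2 n + 24)%N.

(* The product [83 * 100] avoids a large unary numeral. *)
Lemma square_le_exp l : (83 * 100 * (3 * l + 24) ^ 2 <= 2 ^ (l + 24))%N.
Proof.
elim: l => [|l IHl].
  have e8 : (2 ^ 8 = 256)%N by [].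
  rewrite muln0 !add0n (_ : 24 = 8 * 3)%N; last by lia.
  rewrite expnM e8 !expnS !expn0; lia.
rewrite addSn [leqRHS]expnS.
apply: leq_trans (_ : 2 * (83 * 100 * (3 * l + 24) ^ 2) <= _)%N.
  by rewrite -!mulnn; nia.
by rewrite leq_mul2l IHl orbT.
Qed.

(** The left side is 24 a^2 + 132 a + 176 <= 332 a^2, and a <= 5 n m turns this into 83 * 100 * n^2
    m^2, up to rounding [n]. As [m] is logarithmic in [n], the third factor [n] in 2^m together with
    the constant 2^24 absorbs m^2. *)
Lemma growth_large n (m := growth_exp n) (a := (n * (2 * m + 3))%N) : (0 < n)%N ->
  (4 * (2 + (3 * a + 5).+1 * (2 * a.+1 + 5)) <= 2 ^ m)%N.
Proof.
move=> n0; pose l := up_log 2 n.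
have nl : (n <= 2 ^ l)%N by apply: up_logP.
have mE : m = (3 * l + 24)%N by [].
have a0 : (0 < a)%N by rewrite muln_gt0 n0 addn3.
have am : (a <= 5 * (n * m))%N by rewrite /a; nia.
apply: (@leq_trans (332 * a ^ 2)%N); first by rewrite -mulnn; nia.
apply: (@leq_trans (332 * (5 * (2 ^ l * m)) ^ 2)%N).
  by rewrite leq_mul2l leq_sqr (leq_trans am) // leq_mul2l leq_mul2r nl !orbT.
have -> : (332 * (5 * (2 ^ l * m)) ^ 2 = (2 ^ l) ^ 2 * (83 * 100 * m ^ 2))%N.
  rewrite !expnMn; lia.
have -> : (2 ^ m = (2 ^ l) ^ 2 * 2 ^ (l + 24))%N.
  by rewrite -expnM -expnD mE; congr (_ ^ _)%N; lia.
by rewrite leq_mul2l mE square_le_exp orbT.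
Qed.

(** Since (3/4)^3 = 27/64 <= 1/2, three phases gain a factor 2, and [3 * (a + 2)] phases reach 1/(4
    * 2^a). *)
Lemma draws_enough a : (4 * 2 ^ a * 3 ^ (3 * a + 5).+1 <= 4 ^ (3 * a + 5).+1)%N.
Proof.
have -> : ((3 * a + 5).+1 = 3 * (a + 2))%N by lia.
have -> : (4 * 2 ^ a = 2 ^ (a + 2))%N by rewrite expnD mulnC.
by rewrite !(expnM _ 3) -expnMn leq_exp2r // addn2.
Qed.

Lemma dim_ceil_gt {R : realType} (d : R) : d < (dim_ceil d)%:R.
Proof. exact: truncnS_gt. Qed.

Lemma dim_ceil_le {R : realType} (d : R) : 0 <= d -> (dim_ceil d)%:R <= d + 1.
Proof. by move=> d0; rewrite /dim_ceil -natr1 lerD2r truncn_le. Qed.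

Lemma growth_le n : (0 < n)%N -> (2 ^ growth_exp n <= 2 ^ 24 * (2 * n) ^ 3)%N.
Proof.
move=> n0; rewrite /growth_exp addnC expnD leq_mul2l; apply/orP; right.
rewrite [(3 * _)%N]mulnC expnM leq_exp2r //.
case: n n0 => [|[|n]] // _; have /(_ isT)/andP[+ _] := @up_log_bounds 2 n.+2 isT.
have : (0 < up_log 2 n.+2)%N by rewrite up_log_gt0.
by case: (up_log 2 n.+2) => // l _ /= ln; rewrite expnS leq_pmul2l // ltnW.
Qed.

Theorem theorem3p4 (R : realType) :
  exists (rho : R) (mu s e : R -> R),
    [/\ 0 < rho,
        (forall d : R, 0 <= d -> 1 < mu d) /\ is_tildeO mu (fun d => d ^+ 3),
        is_tildeO s (fun d => d),
        is_bigO e (fun d => d)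
      & forall (d : R) (V : finType) (G : wgraph R V),
          0 <= d -> connected_graph G -> normalized_graph G -> doubling_dim G d ->
          exists F : seq (seq {set {set V}}),
            [/\ is_HPF G rho (mu d) F,
                (size F)%:R <= 2 `^ s d
              & forall P (i : nat) (C : {set V}),
                  P \in F -> (i.+1 < size P)%N -> C \in scale_partition P i.+1 ->
                  (cluster_degree P i C)%:R <= mu d `^ e d]].
Proof.
exists 32, (fun d => 2 ^+ growth_exp (dim_ceil d)),
  (fun d => (5 * dim_ceil d)%:R), (fun d => 10 * d).
have max1 (d : R) : 0 <= d -> (dim_ceil d)%:R <= 2 * Num.max 1 `|d|.
  move=> d0; rewrite ger0_norm //; have := dim_ceil_le d0.
  by case: (leP 1 d); lra.
split=> //.
- split=> [d d0|].
    by rewrite exprn_egt1 ?ltr1n // /growth_exp addnS.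
  exists (2 ^+ 24 * 64), 0%N => d d0; rewrite expr0 mulr1.
  rewrite ger0_norm ?exprn_ge0 // normrX.
  have -> : Num.max 1 (`|d| ^+ 3) = Num.max 1 `|d| ^+ 3.
    have [d1|d1] := leP 1 `|d|.
      by rewrite (max_idPr _) // exprn_ege1.
    by rewrite expr1n (max_idPl _) // exprn_ile1 // ltW.
  apply: (@le_trans _ _ (2 ^+ 24 * (2 * (dim_ceil d)%:R) ^+ 3)).
    by rewrite -!natrX -natrM -natrX -natrM ler_nat growth_le.
  rewrite -mulrA ler_wpM2l ?exprn_ge0 //.
  have -> : 64 * Num.max 1 `|d| ^+ 3 = (2 * (2 * Num.max 1 `|d|)) ^+ 3 by ring.
  by rewrite lerXn2r ?nnegrE ?mulr_ge0 ?le_max ?ler01 // ler_wpM2l ?max1.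
- exists 10, 0%N => d d0; rewrite expr0 mulr1 ger0_norm // natrM.
  by have := max1 d d0; lra.
- by exists 10 => d d0; rewrite normrM ger0_norm.
move=> d V G d0 G_conn G_norm G_dim.
set n := dim_ceil d; set m := growth_exp n.
(* For [d < 1] the bound 2^d < 2 leaves one ball per halving, which forces a single vertex and a
   trivial family. *)
have [d1|d1] := ltP d 1.
  have doubling : doubling_bound G 1.
    move=> v r r0; have [S [SK SP]] := G_dim v r r0; exists S; split=> //.
    rewrite -ltnS -(ltr_nat R); apply: le_lt_trans SK _.
    rewrite -[ltRHS]powRr1 // /powR pnatr_eq0 /= ltr_expR.
    by rewrite ltr_pM2r // ln_gt0 // ltr1n.
  have [||F [F_HPF F1 P1]] := @trivial_family _ _ G G_conn 32 (2 ^+ m).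
  - by rewrite exprn_ge0.
  - exact: doubling1_card G_norm G_conn doubling.
  exists F; split=> // [|P i C /P1 ->//].
  by rewrite F1 -[leLHS](powRr0 2) ler_powR // ler1n.
have doubling : doubling_bound G (2 ^ n).
  move=> v r r0; have [S [SK SP]] := G_dim v r r0; exists S; split=> //.
  rewrite -(ler_nat R) natrX; apply: le_trans SK _.
  by rewrite -powR_mulrn // ler_powR ?ler1n // ltW // dim_ceil_gt.
pose a := (n * (2 * m + 3))%N.
have aE : ((2 ^ n) ^ (2 * m + 3) = 2 ^ a)%N by rewrite -expnM.
have [||||||F [F_HPF F_size F_deg]] :=
  @family_exists _ _ G (2 ^ n) m a.+1 (3 * a + 5) doubling.
- by rewrite expn_gt0.
- by rewrite aE expnS.
- by rewrite aE draws_enough.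
- exact: growth_large.
- exact: G_norm.
- exact: G_conn.
exists F; split=> // [|P i C PF iP CP].
  by rewrite F_size -expnM mulnC powR_mulrn // natrX.
apply: (@le_trans _ _ (2 ^ a)%:R); first by rewrite ler_nat -aE F_deg.
(* Here a = n (2 m + 3) <= 5 n m gives 2^a <= mu^(5 n); then 5 n <= 5 (d + 1) <= 10 d because
   [1 <= d]. *)
apply: (@le_trans _ _ ((2 ^+ m) `^ (5 * n)%:R)).
  rewrite powR_mulrn ?exprn_ge0 // -exprM natrX ler_eXn2l ?ltr1n //.
  by rewrite /a /m /growth_exp; nia.
rewrite ler_powR ?exprn_ege1 ?ler1n // natrM.
by have := dim_ceil_le d0; rewrite -/n; lra.
Qed.
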